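(* Let $\theta,\eta\in\mathbb R$, $d,e\in\mathbb N$ and $\mu,\nu\in{}^{\star}\mathbb{PR}_{\varepsilon}$. The resultant product defines a well-defined Cauchy bilinear map \[{}^{*}\mathsf Z^{\mu}_{\mu^{e-1}\cdot\nu^{e}}(\theta)_d\times{}^{*}\mathsf Z^{\nu}_{\mu^{d}\cdot\nu^{d-1}}(\eta)_e\xrightarrow{\ \boxtimes\ }{}^{*}\mathsf Z^{\mu\cdot\nu}(\theta\eta)_{de},\] (Cauchy bilinear meaning $({}^{*}f\cdot{}^{*}f')\boxtimes{}^{*}g=({}^{*}f\boxtimes{}^{*}g)\cdot({}^{*}f'\boxtimes{}^{*}g)$ and similarly in the second variable), which for $d=e=1$ agrees with the linear approximate ideal product, i.e. sends $({}^{*}mX-{}^{*}m^{\perp},{}^{*}nX-{}^{*}n^{\perp})$ to ${}^{*}m{}^{*}nX-{}^{*}m^{\perp}{}^{*}n^{\perp}$.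
   Context: Fix a nonprincipal ultrafilter $\mathfrak u$ on $\mathbb N$; ${}^{*}S=S^{\mathbb N}/\mathfrak u$ denotes ultrapowers, operations componentwise; $x\simeq y$ means $x-y$ infinitesimal. ${}^{*}\mathbb Z[X]$: polynomials of standard finite degree with coefficients in ${}^{*}\mathbb Z$. $({}^{*}\mathbb R_{\rm fin})^{\times}_{+}$ is the group of positive elements neither infinite nor infinitesimal; ${}^{\star}\mathbb{PR}=({}^{*}\mathbb R_{+}\cup\{0\})/({}^{*}\mathbb R_{\rm fin})^{\times}_{+}$, ordered via representatives, with induced product ($\mu^0$ is the class of $1$); $\langle x\rangle$ is the class of $|x|$; ${}^{\star}\mathbb{PR}_{\varepsilon}$ is the set of classes of positive infinitesimals. Height $\mathfrak h$: max absolute value of coefficients. For ${}^{*}f$ with $\deg{}^{*}f\le D$ and $t\in\mathbb R$: growth $\mu_D({}^{*}f)=\langle\mathfrak h({}^{*}f)^{-1/D}\rangle$, decay $\nu_D({}^{*}f)=\langle|{}^{*}f(t)|^{1/D}\rangle$. For $t\in\mathbb R$: ${}^{*}\mathsf Z^{\mu}(t)_D=\{{}^{*}f\in{}^{*}\mathbb Z[X]:\deg{}^{*}f\le D,\ {}^{*}f(t)\simeq0,\ \mu_D({}^{*}f)>\mu\}$ and ${}^{*}\mathsf Z^{\mu}_{\nu}(t)_D$ its subset with $\nu_D({}^{*}f)\le\nu$ (decay computed at $t$). Resultant product: for $f=a_m\prod_{i=1}^m(X-\alpha_i)$, $g=b_n\prod_{j=1}^n(X-\beta_j)$ of degrees $m,n\ge1$,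 $f\boxtimes g=a_m^nb_n^m\prod_{i,j}(X-\alpha_i\beta_j)$ (a polynomial with coefficients in the same ring, of degree $mn$), extended componentwise; it is applied to elements of positive degree. *)

(* Defs.v *)
From HB Require Import structures.
From mathcomp Require Import all_boot all_order all_algebra generic_quotient.
From mathcomp Require Import boolp classical_sets functions filter reals exp.
From mathcomp.real_closed Require Import complex.

Set Implicit Arguments.
Unset Strict Implicit.
Unset Printing Implicit Defensive.

Import Order.TTheory GRing.Theory Num.Theory.
Local Open Scope classical_set_scope.
Local Open Scope ring_scope.
Local Open Scope quotient_scope.

Record npultra := NPUltra {
  usets :> set nat -> Prop;
  usets_ultra : UltraFilter usets;
  usets_nonprincipal : forall n : nat, ~ usets [set n]
}.

Section UltraFilterFacts.
Variable U : npultra.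
Implicit Types A B : set nat.

#[local] Instance UU : UltraFilter (usets U) := usets_ultra U.

Lemma usetsT A : (forall n, A n) -> U A.
Proof. by move=> hA; apply: filterS filterT => n _. Qed.

Lemma usetsS A B : (forall n, A n -> B n) -> U A -> U B.
Proof. exact: filterS. Qed.

Lemma usetsI A B : U A -> U B -> U (A `&` B).
Proof. exact: filterI. Qed.

Lemma usetsC A : ~ U A -> U (~` A).
Proof. by have [] := in_ultra_setVsetC A UU. Qed.

Lemma usets0 : ~ U set0.
Proof. exact: filter_not_empty. Qed.

Lemma usetsU A B : U (A `|` B) -> U A \/ U B.
Proof.
move=> UAB; have [|/usetsC nA] := pselect (U A); first by left.
right; apply: usetsS (usetsI UAB nA) => n [[]] //.
Qed.
End UltraFilterFacts.

Section Ultrapower.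
Variables (U : npultra) (S : choiceType).

Definition ueq : rel (nat -> S) := fun s t => `[< U [set n | s n = t n] >].

Fact ueq_equiv : equiv_class_of ueq.
Proof.
split.
- by move=> s; apply/asboolP/usetsT.
- by move=> s t; apply/asboolP/asboolP; apply: usetsS => n /= ->.
- move=> s t v /asboolP h1 /asboolP h2; apply/asboolP.
  by apply: usetsS (usetsI h1 h2) => n /= [-> ->].
Qed.

Canonical ueq_equivRel := EquivRelPack ueq_equiv.

Definition ustar := {eq_quot ueq_equivRel}.
HB.instance Definition _ := Choice.on ustar.

Definition umk (s : nat -> S) : ustar := \pi_{eq_quot ueq_equivRel} s.
Definition urep (x : ustar) : nat -> S := repr (x : {eq_quot ueq_equivRel}).
Definition ustd (a : S) : ustar := umk (fun=> a).

Lemma urepK x : umk (urep x) = x.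
Proof. exact: reprK. Qed.

Lemma umkP s t : umk s = umk t <-> U [set n | s n = t n].
Proof.
rewrite /umk; split; first by move=> /eqmodP /asboolP.
by move=> h; apply/eqmodP/asboolP.
Qed.

Lemma umk_rep s : U [set n | urep (umk s) n = s n].
Proof. by apply/umkP; rewrite urepK. Qed.

Lemma umk_surj x : exists s, x = umk s.
Proof. by exists (urep x); rewrite urepK. Qed.

Definition urel1 (P : S -> Prop) (x : ustar) := U [set n | P (urep x n)].
Definition urel2 (P : S -> S -> Prop) (x y : ustar) :=
  U [set n | P (urep x n) (urep y n)].

Lemma urel1E P s : urel1 P (umk s) <-> U [set n | P (s n)].
Proof.
split=> h; apply: usetsS (usetsI (umk_rep s) h) => n /= [e]; rewrite ?e //.
Qed.

Lemma urel2E P s t : urel2 P (umk s) (umk t) <-> U [set n | P (s n) (t n)].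
Proof.
split=> h; apply: usetsS (usetsI (usetsI (umk_rep s) (umk_rep t)) h) => n /=;
  by move=> [[e1 e2]]; rewrite ?e1 ?e2.
Qed.
End Ultrapower.

Arguments umk {U S} s.
Arguments ustd {U S} a.

Definition umap (U : npultra) (S T : choiceType) (f : S -> T)
  (x : ustar U S) : ustar U T := umk (fun n => f (urep x n)).
Definition umap2 (U : npultra) (S T V : choiceType) (f : S -> T -> V)
  (x : ustar U S) (y : ustar U T) : ustar U V :=
  umk (fun n => f (urep x n) (urep y n)).

Lemma umapE (U : npultra) (S T : choiceType) (f : S -> T) (s : nat -> S) :
  umap f (umk s) = umk (fun n => f (s n)) :> ustar U T.
Proof. by apply/umkP; apply: usetsS (umk_rep U s) => n /= ->. Qed.

Lemma umap2E (U : npultra) (S T V : choiceType) (f : S -> T -> V)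
    (s : nat -> S) (t : nat -> T) :
  umap2 f (umk s) (umk t) = umk (fun n => f (s n) (t n)) :> ustar U V.
Proof.
by apply/umkP; apply: usetsS (usetsI (umk_rep U s) (umk_rep U t))
  => n /= [-> ->].
Qed.

Section UZmod.
Variables (U : npultra) (S : zmodType).
Let T := ustar U S.
Let add : T -> T -> T := umap2 +%R.
Let opp : T -> T := umap -%R.
Let zero : T := ustd 0.

Fact uaddA : associative add.
Proof.
move=> x y z; have [s ->] := umk_surj x; have [t ->] := umk_surj y;
have [v ->] := umk_surj z.
rewrite /add (umap2E _ _ s t) (umap2E _ _ t v) !umap2E.
by apply/umkP/usetsT => n /=; rewrite addrA.
Qed.
Fact uaddC : commutative add.
Proof.
move=> x y; have [s ->] := umk_surj x; have [t ->] := umk_surj y.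
rewrite /add !umap2E.
by apply/umkP/usetsT => n /=; rewrite addrC.
Qed.
Fact uadd0 : left_id zero add.
Proof.
move=> x; have [s ->] := umk_surj x; rewrite /add /zero /ustd umap2E.
by apply/umkP/usetsT => n /=; rewrite add0r.
Qed.
Fact uaddN : left_inverse zero opp add.
Proof.
move=> x; have [s ->] := umk_surj x; rewrite /add /opp /zero /ustd umapE umap2E.
by apply/umkP/usetsT => n /=; rewrite addNr.
Qed.

HB.instance Definition _ := GRing.isZmodule.Build (ustar U S)
  uaddA uaddC uadd0 uaddN.
End UZmod.

Section URing.
Variables (U : npultra) (S : comNzRingType).
Let T := ustar U S.
Let mul : T -> T -> T := umap2 *%R.
Let one : T := ustd 1.

Fact umulA : associative mul.
Proof.
move=> x y z; have [s ->] := umk_surj x; have [t ->] := umk_surj y;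
have [v ->] := umk_surj z.
rewrite /mul (umap2E _ _ s t) (umap2E _ _ t v) !umap2E.
by apply/umkP/usetsT => n /=; rewrite mulrA.
Qed.
Fact umulC : commutative mul.
Proof.
move=> x y; have [s ->] := umk_surj x; have [t ->] := umk_surj y.
rewrite /mul !umap2E.
by apply/umkP/usetsT => n /=; rewrite mulrC.
Qed.
Fact umul1 : left_id one mul.
Proof.
move=> x; have [s ->] := umk_surj x; rewrite /mul /one /ustd umap2E.
by apply/umkP/usetsT => n /=; rewrite mul1r.
Qed.
Fact umulDl : left_distributive mul +%R.
Proof.
move=> x y z; have [s ->] := umk_surj x; have [t ->] := umk_surj y;
have [v ->] := umk_surj z.
rewrite /mul /GRing.add /= (umap2E _ _ s t) (umap2E _ _ s v) (umap2E _ _ t v).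
rewrite !umap2E.
by apply/umkP/usetsT => n /=; rewrite mulrDl.
Qed.
Fact uone_neq0 : one != 0.
Proof.
apply/eqP => /umkP h; apply: (@usets0 U); apply: usetsS h => n /= /eqP.
by rewrite oner_eq0.
Qed.

HB.instance Definition _ := GRing.Zmodule_isComNzRing.Build (ustar U S)
  umulA umulC umul1 umulDl uone_neq0.
End URing.

Section UUnitRing.
Variables (U : npultra) (S : comUnitRingType).
Let T := ustar U S.
Definition uunit : pred T :=
  fun x => `[< urel1 (fun a => a \is a GRing.unit) x >].
Definition uinv : T -> T := umap GRing.inv.

Fact umulV : {in uunit, left_inverse 1 uinv *%R}.
Proof.
move=> x; have [s ->] := umk_surj x => /asboolP/urel1E h.
rewrite /uinv umapE /GRing.mul /= umap2E.
by apply/umkP; apply: usetsS h => n /= h; rewrite mulVr.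
Qed.
Fact uunitP x y : y * x = 1 -> uunit x.
Proof.
have [s ->] := umk_surj x; have [t ->] := umk_surj y.
rewrite /GRing.mul /= umap2E => /umkP h.
by apply/asboolP/urel1E; apply: usetsS h => n /= h; apply/unitrPr; exists (t n);
  rewrite mulrC.
Qed.
Fact uinv_out : {in [predC uunit], uinv =1 id}.
Proof.
move=> x; have [s ->] := umk_surj x.
rewrite inE => /asboolP h.
rewrite /uinv umapE; apply/umkP.
have /usetsC : ~ U [set n | s n \is a GRing.unit] by move=> k; apply: h; apply/urel1E.
by apply: usetsS => n /= /negP; apply: invr_out.
Qed.

HB.instance Definition _ := GRing.ComNzRing_hasMulInverse.Build (ustar U S)
  umulV uunitP uinv_out.
End UUnitRing.

Section UIdomain.
Variables (U : npultra) (S : idomainType).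
Fact umul_eq0 : GRing.integral_domain_axiom (ustar U S).
Proof.
move=> x y; have [s ->] := umk_surj x; have [t ->] := umk_surj y.
rewrite /GRing.mul /= umap2E => /umkP h.
have /usetsU [] : U ([set n | s n = 0] `|` [set n | t n = 0]).
- by apply: usetsS h => n /= /eqP; rewrite mulf_eq0 => /orP[] /eqP; [left|right].
- by move=> h0; apply/orP; left; apply/eqP/umkP.
- by move=> h0; apply/orP; right; apply/eqP/umkP.
Qed.
HB.instance Definition _ :=
  GRing.ComUnitRing_isIntegral.Build (ustar U S) umul_eq0.
End UIdomain.

Section UField.
Variables (U : npultra) (S : fieldType).
Fact ufieldP : GRing.field_axiom (ustar U S).
Proof.
move=> x; have [s ->] := umk_surj x => /eqP nz; apply/asboolP/urel1E.
have /usetsC : ~ U [set n | s n = 0] by move=> h; apply: nz; apply/umkP.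
by apply: usetsS => n /= /eqP; rewrite unitfE.
Qed.
HB.instance Definition _ := GRing.UnitRing_isField.Build (ustar U S) ufieldP.
End UField.

Section UOrder.
Variables (U : npultra) (S : realDomainType).
Let T := ustar U S.
Definition ule : rel T := fun x y => `[< urel2 (fun a b => a <= b) x y >].
Definition ult : rel T := fun x y => (y != x) && ule x y.
Definition unorm : T -> T := umap Num.norm.

Lemma uleE s t : ule (umk s) (umk t) <-> U [set n | s n <= t n].
Proof.
split; first by move=> /asboolP/urel2E.
by move=> h; apply/asboolP/urel2E.
Qed.

Fact ule0_add x y : ule 0 x -> ule 0 y -> ule 0 (x + y).
Proof.
have [s ->] := umk_surj x; have [t ->] := umk_surj y => /uleE h1 /uleE h2.
rewrite /GRing.add /= umap2E; apply/uleE.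
by apply: usetsS (usetsI h1 h2) => n /= []; apply: addr_ge0.
Qed.
Fact ule0_mul x y : ule 0 x -> ule 0 y -> ule 0 (x * y).
Proof.
have [s ->] := umk_surj x; have [t ->] := umk_surj y => /uleE h1 /uleE h2.
rewrite /GRing.mul /= umap2E; apply/uleE.
by apply: usetsS (usetsI h1 h2) => n /= []; apply: mulr_ge0.
Qed.
Fact ule0_anti x : ule 0 x -> ule x 0 -> x = 0.
Proof.
have [s ->] := umk_surj x => /uleE h1 /uleE h2; apply/umkP.
apply: usetsS (usetsI h1 h2) => n /= [p q].
by apply/eqP; rewrite eq_le p q.
Qed.
Fact usub_ge0 x y : ule 0 (y - x) = ule x y.
Proof.
have [s ->] := umk_surj x; have [t ->] := umk_surj y.
rewrite /GRing.add /GRing.opp /= umapE umap2E.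
by apply/idP/idP => /uleE h; apply/uleE; apply: usetsS h => n /=;
  rewrite subr_ge0.
Qed.
Fact ule0_total x : ule 0 x || ule x 0.
Proof.
have [s ->] := umk_surj x; apply/orP.
have /usetsU [] : U ([set n | 0 <= s n] `|` [set n | s n <= 0]).
- by apply: usetsT => n /=; apply/orP; apply: le_total.
- by move=> h; left; apply/uleE.
- by move=> h; right; apply/uleE.
Qed.
Fact unormN x : unorm (- x) = unorm x.
Proof.
have [s ->] := umk_surj x; rewrite /unorm /GRing.opp /= (umapE _ -%R) !umapE.
by apply/umkP/usetsT => n /=; rewrite normrN.
Qed.
Fact uge0_norm x : ule 0 x -> unorm x = x.
Proof.
have [s ->] := umk_surj x => /uleE h; rewrite /unorm umapE; apply/umkP.
by apply: usetsS h => n /=; apply: ger0_norm.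
Qed.

HB.instance Definition _ := Num.IntegralDomain_isLeReal.Build (ustar U S)
  ule0_add ule0_mul ule0_anti usub_ge0 ule0_total unormN uge0_norm
  (fun _ _ => erefl).
End UOrder.

HB.instance Definition _ (U : npultra) (S : realFieldType) :=
  GRing.Field.on (ustar U S).

Section ProjectiveReals.
Variables (U : npultra) (R : realType).
Implicit Types (x y u : ustar U R) (a b : R).

Definition infinitesimal x : Prop := forall a, 0 < a -> `|x| < ustd a.
Definition infinite x : Prop := forall a, ustd a < `|x|.
Definition infclose x y : Prop := infinitesimal (x - y).

Definition finunit_pos : set (ustar U R) :=
  [set u | [/\ 0 < u, ~ infinite u & ~ infinitesimal u]].

Lemma ustdM a b : ustd (a * b) = ustd a * ustd b :> ustar U R.
Proof. by rewrite /GRing.mul /= umap2E. Qed.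

Lemma ustd_gt0 a : 0 < a -> 0 < ustd a :> ustar U R.
Proof.
move=> a0; rewrite lt_neqAle; apply/andP; split; last first.
  by apply/uleE/usetsT => n /=; apply: ltW.
apply/eqP => /umkP h; apply: (@usets0 U); apply: usetsS h => n /= h.
by move: a0; rewrite -h ltxx.
Qed.

Lemma ustdV a : 0 < a -> ustd a^-1 = (ustd a)^-1 :> ustar U R.
Proof.
move=> a0; apply: (@mulIf _ (ustd a)); first by rewrite gt_eqF // ustd_gt0.
by rewrite -ustdM !mulVf // ?gt_eqF // ustd_gt0.
Qed.

Lemma finunit_posP u :
  finunit_pos u <-> exists a b, [/\ 0 < a, ustd a <= u & u <= ustd b].
Proof.
split.
- move=> [u0 /existsNP[b /negP]]; rewrite -leNgt gtr0_norm // => ub.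
  move=> /existsNP[a /not_implyP[a0 /negP]]; rewrite -leNgt gtr0_norm // => au.
  by exists a, b.
- move=> [a [b [a0 au ub]]].
  have u0 : 0 < u by apply: lt_le_trans au; apply: ustd_gt0.
  split=> //.
  + by move=> /(_ b); rewrite gtr0_norm // ltNge ub.
  + by move=> /(_ a a0); rewrite gtr0_norm // ltNge au.
Qed.

Lemma finunit_pos_gt0 u : finunit_pos u -> 0 < u.
Proof. by case. Qed.

Lemma finunit_pos1 : finunit_pos 1.
Proof. by apply/finunit_posP; exists 1, 1; rewrite ltr01 !lexx. Qed.

Lemma finunit_posM u v :
  finunit_pos u -> finunit_pos v -> finunit_pos (u * v).
Proof.
move=> /finunit_posP[a [b [a0 au ub]]] /finunit_posP[a' [b' [a0' av vb]]].
apply/finunit_posP; exists (a * a'), (b * b'); rewrite mulr_gt0 // !ustdM.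
have u0 : 0 < u by apply: lt_le_trans au; apply: ustd_gt0.
have v0 : 0 < v by apply: lt_le_trans av; apply: ustd_gt0.
by split=> //; apply: ler_pM => //; apply: ltW => //; apply: ustd_gt0.
Qed.

Lemma finunit_posV u : finunit_pos u -> finunit_pos u^-1.
Proof.
move=> /finunit_posP[a [b [a0 au ub]]].
have u0 : 0 < u by apply: lt_le_trans au; apply: ustd_gt0.
have b0 : 0 < b.
  rewrite ltNge; apply/negP => b0.
  have : ustd b <= 0 :> ustar U R by apply/uleE/usetsT.
  by rewrite leNgt (lt_le_trans u0 ub).
apply/finunit_posP; exists b^-1, a^-1; rewrite invr_gt0 b0 !ustdV //.
by split=> //; rewrite lef_pV2 // ?posrE // ustd_gt0.
Qed.

Definition nneg := {x : ustar U R | 0 <= x}.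

Definition preq : rel nneg :=
  fun p q : nneg => `[< exists2 u, finunit_pos u & val q = u * val p >].

Fact preq_equiv : equiv_class_of preq.
Proof.
have sym (x y : nneg) : preq x y -> preq y x.
  move=> /asboolP[u fu e]; apply/asboolP; exists u^-1; first exact: finunit_posV.
  by rewrite e mulKf // gt_eqF // finunit_pos_gt0.
split.
- move=> x; apply/asboolP; exists 1; last by rewrite mul1r.
  exact: finunit_pos1.
- by move=> x y; apply/idP/idP; apply: sym.
- move=> y x z /asboolP[u fu e] /asboolP[v fv e'].
  by apply/asboolP; exists (v * u); [exact: finunit_posM|rewrite e' e mulrA].
Qed.

Canonical preq_equivRel := EquivRelPack preq_equiv.

Definition PR := {eq_quot preq_equivRel}.

Definition nnorm x : nneg := exist _ `|x| (normr_ge0 x).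
Definition prcls x : PR := \pi_{eq_quot preq_equivRel} (nnorm x).
Definition prrep (p : PR) : ustar U R := val (repr p : nneg).

Lemma prrep_ge0 p : 0 <= prrep p.
Proof. exact: (valP (repr p : nneg)). Qed.

Lemma prrepK p : prcls (prrep p) = p.
Proof.
rewrite -[RHS]reprK /prcls; congr (\pi_ _ _); apply: val_inj => /=.
by rewrite ger0_norm // prrep_ge0.
Qed.

Lemma prclsP x y :
  prcls x = prcls y <-> exists2 u, finunit_pos u & `|y| = u * `|x|.
Proof.
rewrite /prcls; split; first by move=> /eqmodP /asboolP.
by move=> h; apply/eqmodP/asboolP.
Qed.

Definition prle (p q : PR) : Prop :=
  exists x y, [/\ 0 <= x, 0 <= y, prcls x = p, prcls y = q & x <= y].
Definition prlt (p q : PR) : Prop := prle p q /\ p <> q.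

Definition prmul (p q : PR) : PR := prcls (prrep p * prrep q).
Definition prexp (p : PR) (n : nat) : PR := iter n (prmul p) (prcls 1).

Lemma prmulE x y : prmul (prcls x) (prcls y) = prcls (x * y).
Proof.
have [u fu eu] : exists2 u, finunit_pos u & `|x| = u * `|prrep (prcls x)|.
  by apply/prclsP; rewrite prrepK.
have [v fv ev] : exists2 u, finunit_pos u & `|y| = u * `|prrep (prcls y)|.
  by apply/prclsP; rewrite prrepK.
apply/prclsP; exists (u * v); first exact: finunit_posM.
by rewrite !normrM eu ev mulrACA.
Qed.

Definition PReps : set PR :=
  [set p | exists x, [/\ 0 < x, infinitesimal x & p = prcls x]].

End ProjectiveReals.

Section ApproximateIdeals.
Variables (U : npultra) (R : realType).
Local Notation starZ := (ustar U int).
Local Notation starR := (ustar U R).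
Implicit Types (F G : {poly starZ}) (t : R) (D : nat).

Definition starZR : starZ -> starR := umap (fun z : int => z%:~R).

Definition ueval F t : starR := (map_poly starZR F).[ustd t].

Definition height F : starZ := \big[Num.max/0]_(i < size F) `|F`_i|.

Definition growth D F : PR U R :=
  prcls (umap (fun x : R => x `^ (- D%:R^-1)) (starZR (height F))).

Definition decay D t F : PR U R :=
  prcls (umap (fun x : R => x `^ D%:R^-1) `|ueval F t|).

(* The value of [growth] at 0 is junk, namely the class of 0: with this
   convention 0 never belongs to the sets below (for D > 0). *)
Definition Zmu (mu : PR U R) t D : set {poly starZ} :=
  [set F : {poly starZ} | [/\ (size F <= D.+1)%N, infclose (ueval F t) 0
             & prlt mu (growth D F)]].

Definition Zmunu (mu nu : PR U R) t D : set {poly starZ} :=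
  [set F : {poly starZ} | Zmu mu t D F /\ prle (decay D t F) nu].

End ApproximateIdeals.

Section ResultantProduct.
Variable R : realType.

Definition rootsC (p : {poly R[i]}) : seq R[i] :=
  sval (closed_field_poly_normal p).

Definition resprodC (p q : {poly R[i]}) : {poly R[i]} :=
  (lead_coef p ^+ (size q).-1 * lead_coef q ^+ (size p).-1) *:
    \prod_(x <- rootsC p) \prod_(y <- rootsC q) ('X - (x * y)%:P).

Definition polyZC : {poly int} -> {poly R[i]} :=
  map_poly (fun z : int => z%:~R).

(* [xget] picks the integer polynomial with the prescribed image in C[X] (it is
   unique, and would default to 0 if the formula on roots were not integral). *)
Definition resprod (f g : {poly int}) : {poly int} :=
  xget 0 [set h | polyZC h = resprodC (polyZC f) (polyZC g)].

Variable U : npultra.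
Local Notation starZ := (ustar U int).

(* The bound N is needed: a sequence of unbounded degree may agree with F in
   each coefficient for U-almost all n. *)
Definition represents (f : nat -> {poly int}) (F : {poly starZ}) : Prop :=
  (exists N : nat, U [set n | (size (f n) <= N)%N]) /\
  forall i : nat, F`_i = umk (fun n => (f n)`_i).

Definition pcomp (F : {poly starZ}) (n : nat) : {poly int} :=
  \poly_(i < size F) urep F`_i n.

Lemma represents_pcomp F : represents (pcomp F) F.
Proof.
split; first by exists (size F); apply: usetsT => n /=; apply: size_poly.
move=> i; have [lt_i|ge_i] := ltnP i (size F).
- rewrite -[LHS]urepK; apply/umkP/usetsT => n /=.
  by rewrite coef_poly lt_i.
- rewrite nth_default //; apply/umkP/usetsT => n /=.
  by rewrite coef_poly ltnNge ge_i.
Qed.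

Definition uresprod (F G : {poly starZ}) : {poly starZ} :=
  \poly_(i < ((size F).-1 * (size G).-1).+1)
    umk (fun n => (resprod (pcomp F n) (pcomp G n))`_i).

End ResultantProduct.

(* Main.v *)
Require Import Defs.
From mathcomp Require Import all_boot all_order all_algebra.
From mathcomp Require Import boolp classical_sets reals.
From mathcomp Require Import all_fingroup exp ring zify.
From mathcomp.real_closed Require Import complex.

Import Order.TTheory GRing.Theory Num.Theory.
Local Open Scope ring_scope.
Local Open Scope classical_set_scope.

(** Let [f], [g] have degrees [m], [n] and heights at most [hf], [hg].  The
    resultant product is the resultant in [Y] of [f(Y)] and
    [\sum_l g_l X^l Y^(n - l)], that is, the determinant of a Sylvester matrix
    with [m] rows built from [g] and [n] rows built from [f].  This gives
    integrality, and expanding the determinant bounds the height of the product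
    by [(m + n)! hf^n hg^m].  A column operation at [X = theta eta] puts the
    values at [Y = theta] of the row polynomials in the first column; they are
    multiples of [f(theta)] or [g(eta)], whence a bound
    [O(|f(theta)| hf^(n-1) hg^m + |g(eta)| hf^n hg^(m-1))] for the value of the
    product.  If [s], [t] represent [mu], [nu], the growth conditions say that
    [a = s^d hf] and [b = t^e hg] are infinitesimal; the height of the product
    times [(st)^(de)] is then [O(a^e b^d)], and the decay conditions make its
    value [O(a^(e-1) b^d + a^e b^(d-1))]. *)

(* The partial composition of [ssrfun] has the same name. *)
Local Notation pcomp := Defs.pcomp.

(** * Sylvester determinants *)

(** Listing the rows of [q] first and the low coefficients on the left makes the product formula for
    the resultant hold without a sign. The formal degrees are parameters rather than sizes, so the
    matrix can be specialised even when a degree drops. *)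
Definition syl_row {A : comNzRingType} (m : nat) (f q : {poly A}) (i : nat) :
  {poly A} := if (i < m)%N then q * 'X^i else f * 'X^(i - m).

Definition syl {A : comNzRingType} (m n : nat) (f q : {poly A}) : 'M[A]_(m + n) :=
  \matrix_(i, j) (syl_row m f q i)`_j.

Lemma size_syl_row {A : comNzRingType} (m n : nat) (f q : {poly A}) (i : nat) :
  (size f <= m.+1)%N -> (size q <= n.+1)%N -> (i < m + n)%N ->
  (size (syl_row m f q i) <= m + n)%N.
Proof.
move=> sf sq lti; rewrite /syl_row; case: ltnP => him.
  by apply: (leq_trans (size_polyMleq _ _)); rewrite size_polyXn; lia.
by apply: (leq_trans (size_polyMleq _ _)); rewrite size_polyXn; lia.
Qed.

(** On coefficients, multiplication by [h] is a vector-matrix product; this identifies the entries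
    of [B *m T] below. *)
Lemma coef_mul_sumX {A : comNzRingType} (N : nat) (h p : {poly A}) (j : nat) :
  (size p <= N)%N -> (h * p)`_j = \sum_(k < N) p`_k * (h * 'X^k)`_j.
Proof.
move=> sp.
have {1}-> : p = \sum_(k < N) p`_k *: 'X^k.
  rewrite -poly_def; apply/polyP => i; rewrite coef_poly.
  by case: ltnP => // lei; rewrite nth_default // (leq_trans sp).
rewrite mulr_sumr coef_sum; apply: eq_bigr => k _.
by rewrite -scalerAr coefZ.
Qed.

(* Row operations and division by [X - a] factor the matrix as a block
   triangular one times a unitriangular one. *)
Lemma det_syl_XsubC {A : comNzRingType} (m n : nat) (f q : {poly A}) (a : A) :
  (size f <= m.+1)%N -> (size q <= n.+1)%N ->
  \det (syl m.+1 n (('X - a%:P) * f) q) = q.[a] * \det (syl m n f q).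
Proof.
move=> sf sq; set N := (m + n)%N.
have [q1 hq1] : exists q1, q - (q.[a])%:P = q1 * ('X - a%:P).
  by apply/factor_theorem; rewrite /root !hornerE subrr.
have sq1 : (size q1 <= N)%N.
  suff : (size q1 <= n)%N by move=> h; apply: leq_trans h (leq_addl _ _).
  have [->|q1n0] := eqVneq q1 0; first by rewrite size_poly0.
  have /(congr1 (fun p : {poly A} => size p)) := hq1.
  rewrite size_Mmonic ?monicXsubC // size_XsubC addn2 /= => e.
  rewrite -ltnS -e; apply: (leq_trans (size_polyD _ _)).
  rewrite geq_max sq size_polyN; apply: (leq_trans (size_polyC_leq1 _)).
  by [].
(* [L] subtracts [a] times the preceding row from the rows [q * 'X^i] with [0 < i <= m]; every row
   but the first becomes a multiple of ['X - a%:P]. *)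
pose L : 'M[A]_N.+1 := \matrix_(i, j)
  ((i == j)%:R - a *+ ((i == j.+1 :> nat) && (i <= m)%N)).
(* The rows of [T] form the basis [1], [('X - a%:P) * 'X^k]. In it the first row [q] has coordinates
   [q.[a]] and those of [q1], and the others have the rows of the smaller Sylvester matrix: this is
   [B]. *)
pose T : 'M[A]_N.+1 := \matrix_(k, j)
  (if k == 0 :> nat then 1 else ('X - a%:P) * 'X^(k.-1) : {poly A})`_j.
pose B : 'M[A]_(1 + N) :=
  block_mx (q.[a])%:M (\row_j q1`_j) 0 (syl m n f q).
have detL : \det L = 1.
  rewrite det_trig; last first.
    apply/is_trig_mxP => i j lij; rewrite mxE -val_eqE /= (ltn_eqF lij).
    by rewrite (ltn_eqF (ltnW lij : (i < j.+1)%N)) mulr0n subr0.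
  rewrite big1 // => i _; rewrite mxE eqxx.
  by rewrite (ltn_eqF (ltnSn i)) mulr0n subr0.
have detT : \det T = 1.
  rewrite det_trig; last first.
    apply/is_trig_mxP => i j lij; rewrite mxE.
    case: (posnP i) => i0; first by rewrite coef1 gtn_eqF // (leq_ltn_trans _ lij).
    rewrite nth_default //; apply: leq_trans lij.
    apply: (leq_trans (size_polyMleq _ _)).
    by rewrite size_polyXn size_XsubC; lia.
  rewrite big1 // => i _; rewrite mxE.
  case: posnP => i0; first by rewrite i0 coef1.
  rewrite coefMXn ltnNge leq_pred /= coefB coefX coefC.
  by case: (nat_of_ord i) i0 => //= k _; rewrite subSnn /= subr0.
have BEu i k : B (lshift N i) k = row_mx (q.[a])%:M (\row_j q1`_j) i k.
  by rewrite /B block_mxEv col_mxEu.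
have BEd i k : B (rshift 1 i) k = row_mx 0 (syl m n f q) i k.
  by rewrite /B block_mxEv col_mxEd.
have LB : L *m syl m.+1 n (('X - a%:P) * f) q = B *m T.
  apply/matrixP => i j; rewrite !mxE.
  have -> : \sum_k L i k * syl m.+1 n (('X - a%:P) * f) q k j =
    (syl_row m.+1 (('X - a%:P) * f) q i)`_j -
    (if (0 < i <= m)%N then a * (q * 'X^(i.-1))`_j else 0).
    under eq_bigr do rewrite !mxE mulrBl.
    rewrite sumrB; congr (_ - _).
      rewrite (bigD1 i) //= eqxx mul1r big1 ?addr0 // => k.
      by rewrite eq_sym => /negPf ->; rewrite mul0r.
    case: ifP => [/andP[i0 im]|].
      have lti : (i.-1 < N.+1)%N by case: (i) i0 => k /= lk _; lia.
      rewrite (bigD1 (Ordinal lti)) //= prednK // eqxx im /=.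
      rewrite /syl_row (_ : (i.-1 < m.+1)%N); last by lia.
      rewrite big1 ?addr0 // => k; rewrite -val_eqE /= => kn.
      rewrite (_ : (i == k.+1 :> nat) = false) ?mul0r //.
      by apply/negP => /eqP ik; move: kn; rewrite ik eqxx.
    move=> h; rewrite big1 // => k _.
    rewrite (_ : (_ && _) = false) ?mul0r //.
    by apply/negP => /andP[/eqP ik im]; move: h; rewrite ik -ik im ik.
  case: (split_ordP (i : 'I_(1 + N))) => i' -> {i}.
    under eq_bigr do rewrite BEu.
    rewrite (ord1 i') /= subr0 /syl_row /= mulr1.
    rewrite (@big_split_ord A 0 +%R 1 N) /= big_ord1 row_mxEl !mxE /=.
    under eq_bigr do rewrite row_mxEr !mxE /=.
    rewrite -(coef_mul_sumX N ('X - a%:P)) // [_ * q1]mulrC -hq1 coef1 coefB coefC.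
    by case: eqP => _; rewrite ?mulr1 ?mulr0; ring.
  under eq_bigr do rewrite BEd.
  rewrite (@big_split_ord A 0 +%R 1 N) /= big_ord1 row_mxEl !mxE /= mul0r add0r.
  under eq_bigr do rewrite row_mxEr !mxE /=.
  rewrite -(coef_mul_sumX N ('X - a%:P)); last by apply: size_syl_row.
  rewrite /syl_row add1n ltnS /= subSS; case: ltnP => _; last by rewrite subr0 mulrA.
  by rewrite exprSr mulrBl coefB mul_polyC coefZ [_ * 'X]mulrC mulrCA.
have := congr1 (fun M => \det M) LB.
rewrite !det_mulmx detL detT mul1r mulr1 => ->.
have -> : \det B = \det (q.[a]%:M : 'M_1) * \det (syl m n f q) by exact: det_ublock.
by rewrite det_scalar1.
Qed.

(** Each root splits off one value of [q]; once the roots are exhausted, only the [n] rows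
    [c *: 'X^i] remain, and the matrix is scalar. *)
Lemma det_syl {A : comNzRingType} (c : A) (r : seq A) (n : nat) (q : {poly A}) :
  (size q <= n.+1)%N ->
  \det (syl (size r) n (c *: \prod_(z <- r) ('X - z%:P)) q)
  = c ^+ n * \prod_(z <- r) q.[z].
Proof.
move=> sq; elim: r => [|a r IHr] /=.
  rewrite !big_nil mulr1 (_ : syl _ _ _ _ = c%:M) ?det_scalar //.
  apply/matrixP => i j; rewrite !mxE /syl_row /= subn0 -scalerAl mul1r coefZ coefXn.
  by rewrite eq_sym val_eqE; case: eqP; rewrite ?mulr1 ?mulr0.
rewrite !big_cons scalerAr det_syl_XsubC ?IHr //; first by ring.
by apply: (leq_trans (size_scale_leq _ _)); rewrite size_prod_XsubC.
Qed.

(** * The resultant product as a determinant *)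

(* The homogenisation [\sum_l g_l X^l Y^(n - l)], as a polynomial in [Y]. *)
Definition homogenize {A : comNzRingType} (n : nat) (g : {poly A}) :
  {poly {poly A}} := \poly_(l < n.+1) (g`_(n - l) *: 'X^(n - l)).

Lemma horner_homogenize {A : comNzRingType} (n : nat) (g : {poly A}) (z : A) :
  (homogenize n g).[z%:P] = \poly_(l < n.+1) (g`_l * z ^+ (n - l)).
Proof.
rewrite horner_poly poly_def (reindex_inj rev_ord_inj) /=.
apply: eq_bigr => l _; rewrite subSS subKn; last by rewrite -ltnS.
by rewrite -polyC_exp -scalerAl mulrC mul_polyC scalerA.
Qed.

Lemma homogenize_XsubC {A : comNzRingType} (n : nat) (g : {poly A}) (y z : A) :
  (size g <= n.+1)%N ->
  \poly_(l < n.+2) ((('X - y%:P) * g)`_l * z ^+ (n.+1 - l))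
  = ('X - (z * y)%:P) * \poly_(l < n.+1) (g`_l * z ^+ (n - l)).
Proof.
move=> sg; apply/polyP => i.
rewrite !coef_poly !mulrBl !coefB !coefXM !mul_polyC !coefZ !coef_poly.
case: i => [|i] /=; first by rewrite !subn0 exprS; ring.
rewrite !ltnS subSS; case: (ltnP i n) => hi.
  rewrite (ltnW hi) (_ : (n - i = (n - i.+1).+1)%N); last by lia.
  by rewrite exprS; ring.
by rewrite [g`_i.+1]nth_default ?(leq_trans sg) //; case: ifP => _; ring.
Qed.

(** The left side is [z^n g(X / z)], whose roots are those of [g] multiplied by [z]. Induction on
    the roots avoids the division, so [z] need not be invertible. *)
Lemma homogenize_prod_XsubC {A : comNzRingType} (b z : A) (s : seq A) :
  \poly_(l < (size s).+1)
     ((b *: \prod_(y <- s) ('X - y%:P))`_l * z ^+ (size s - l))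
  = b *: \prod_(y <- s) ('X - (z * y)%:P).
Proof.
elim: s => [|y s IHs].
  apply/polyP => i; rewrite coef_poly !big_nil !coefZ !coef1.
  by case: i => [|i] //=; rewrite ?mulr1 ?mulr0.
rewrite !big_cons !scalerAr -IHs homogenize_XsubC //.
by apply: (leq_trans (size_scale_leq _ _)); rewrite size_prod_XsubC.
Qed.

Definition resdet {A : comNzRingType} (m n : nat) (f g : {poly A}) : {poly A} :=
  \det (syl m n (f^:P) (homogenize n g)).

(** Base change is applied from [int] to [R[i]], where the roots live, and from [int] to [R], where
    the values are estimated. *)
Lemma map_resdet {A B : comNzRingType} (phi : {rmorphism A -> B}) (m n : nat)
    (f g : {poly A}) :
  map_poly phi (resdet m n f g) = resdet m n (map_poly phi f) (map_poly phi g).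
Proof.
rewrite /resdet -det_map_mx; congr (\det _); apply/matrixP => i j.
rewrite !mxE -coef_map; congr ((polyseq _)`_j); rewrite /syl_row.
case: ifP => _; rewrite rmorphM /= map_polyXn; congr (_ * _).
  apply/polyP => l; rewrite coef_map coef_poly [RHS]coef_poly /=; case: ifP => _.
    by rewrite map_polyZ map_polyXn coef_map.
  by rewrite rmorph0.
by apply/polyP => l; rewrite !coef_map /= map_polyC.
Qed.

(** By the product formula, each root [x] of the first polynomial contributes the homogenisation at
    [x], which is [b] times the product of the ['X - (x * y)%:P]. *)
Lemma resdet_prod_XsubC {A : comNzRingType} (a b : A) (r s : seq A) :
  resdet (size r) (size s) (a *: \prod_(x <- r) ('X - x%:P))
    (b *: \prod_(y <- s) ('X - y%:P))
  = (a ^+ size s * b ^+ size r) *: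
      \prod_(x <- r) \prod_(y <- s) ('X - (x * y)%:P).
Proof.
rewrite /resdet.
have -> : (a *: \prod_(x <- r) ('X - x%:P))^:P =
    a%:P *: \prod_(x <- map polyC r) ('X - x%:P).
  rewrite map_polyZ /= rmorph_prod big_map /=; congr (_ *: _).
  by apply: eq_bigr => x _; rewrite rmorphB /= map_polyX map_polyC.
rewrite -(size_map polyC r) det_syl; last exact: size_poly.
rewrite big_map size_map.
under eq_bigr do rewrite horner_homogenize homogenize_prod_XsubC.
rewrite -polyC_exp mul_polyC -scalerA; congr (_ *: _).
rewrite scaler_prod; congr (_ *: _).
by rewrite big_const_seq count_predT iter_mulr_1.
Qed.

(** * Integrality, multiplicativity and degree of the resultant product *)

Section Resprod.
Variable R : realType.

Lemma rootsCE (p : {poly R[i]}) :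
  p = lead_coef p *: \prod_(z <- rootsC p) ('X - z%:P).
Proof. exact: (svalP (closed_field_poly_normal p)). Qed.

Lemma size_rootsC (p : {poly R[i]}) : p != 0 -> size (rootsC p) = (size p).-1.
Proof.
move=> p0; rewrite [in RHS](rootsCE p) size_scale ?lead_coef_eq0 //.
by rewrite size_prod_XsubC.
Qed.

Lemma resprodCE (p q : {poly R[i]}) : p != 0 -> q != 0 ->
  resprodC p q = resdet (size p).-1 (size q).-1 p q.
Proof.
move=> p0 q0; rewrite /resprodC -!size_rootsC //.
by rewrite -resdet_prod_XsubC -!rootsCE.
Qed.

Lemma polyZC_inj : injective (polyZC R).
Proof. by apply: map_inj_poly => //; exact: intr_inj. Qed.

Lemma polyZCM (f g : {poly int}) : polyZC R (f * g) = polyZC R f * polyZC R g.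
Proof. by rewrite /polyZC rmorphM. Qed.

Lemma size_polyZC (f : {poly int}) : size (polyZC R f) = size f.
Proof. by apply: size_map_inj_poly => //; exact: intr_inj. Qed.

Lemma polyZC_eq0 (f : {poly int}) : (polyZC R f == 0) = (f == 0).
Proof. by rewrite -!size_poly_eq0 size_polyZC. Qed.

Lemma lead_coef_polyZC (f : {poly int}) :
  lead_coef (polyZC R f) = (lead_coef f)%:~R.
Proof. by apply: lead_coef_map_inj => //; exact: intr_inj. Qed.

(** The determinant formed over [int] is an integral preimage of the formula on roots: this is the
    integrality of the resultant product. *)
Lemma polyZC_resdet (f g : {poly int}) : f != 0 -> g != 0 ->
  polyZC R (resdet (size f).-1 (size g).-1 f g) =
  resprodC (polyZC R f) (polyZC R g).
Proof.
move=> f0 g0; rewrite resprodCE ?polyZC_eq0 // !size_polyZC.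
exact: (map_resdet (GRing.RMorphism.clone _ _ (fun z : int => z%:~R : R[i]) _)).
Qed.

(** The set searched by [xget] contains the determinant, so the default value 0 does not come from
    an empty search. *)
Lemma polyZC_resprod (f g : {poly int}) : f != 0 -> g != 0 ->
  polyZC R (resprod R f g) = resprodC (polyZC R f) (polyZC R g).
Proof.
move=> f0 g0; rewrite /resprod.
apply: (@xgetPex _ 0 [set h | polyZC R h = resprodC (polyZC R f) (polyZC R g)]).
by exists (resdet (size f).-1 (size g).-1 f g); exact: polyZC_resdet.
Qed.

Lemma resprodE (f g : {poly int}) : f != 0 -> g != 0 ->
  resprod R f g = resdet (size f).-1 (size g).-1 f g.
Proof.
by move=> f0 g0; apply: polyZC_inj; rewrite polyZC_resprod // polyZC_resdet.
Qed.

Lemma resprodC_comm (p q : {poly R[i]}) : resprodC p q = resprodC q p.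
Proof.
rewrite /resprodC exchange_big /= mulrC; congr (_ *: _).
by apply: eq_bigr => x _; apply: eq_bigr => y _; rewrite [x * y]mulrC.
Qed.

Lemma resprod_comm (f g : {poly int}) : resprod R f g = resprod R g f.
Proof. by rewrite /resprod resprodC_comm. Qed.

(** Unique factorisation: [rootsC] chooses some ordering of the roots, and the products over them do
    not depend on it. *)
Lemma rootsC_perm (p : {poly R[i]}) (c : R[i]) (r : seq R[i]) :
  c != 0 -> p = c *: \prod_(z <- r) ('X - z%:P) -> perm_eq (rootsC p) r.
Proof.
move=> c0 pE; apply: prod_XsubC_eq; apply: (scalerI c0); rewrite -pE.
rewrite [in RHS](rootsCE p); congr (_ *: _); rewrite pE lead_coefZ.
by rewrite (monicP (monic_prod_XsubC _ _ _)) mulr1.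
Qed.

(** Roots concatenate, leading coefficients multiply and degrees add. *)
Lemma resprodC_mull (p p' q : {poly R[i]}) : p != 0 -> p' != 0 ->
  resprodC (p * p') q = resprodC p q * resprodC p' q.
Proof.
move=> p0 p'0; rewrite /resprodC.
have pr : perm_eq (rootsC (p * p')) (rootsC p ++ rootsC p').
  apply: (@rootsC_perm _ (lead_coef p * lead_coef p')).
    by rewrite mulf_neq0 ?lead_coef_eq0.
  rewrite [in LHS](rootsCE p) [in LHS](rootsCE p') big_cat /=.
  by rewrite -scalerAl -scalerAr scalerA.
rewrite (perm_big _ pr) big_cat /= -scalerAl -scalerAr scalerA; congr (_ *: _).
rewrite lead_coefM size_mul // exprMn.
have -> : ((size p + size p').-1.-1 = (size p).-1 + (size p').-1)%N.
  by move: p0 p'0; rewrite -!size_poly_gt0; lia.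
by rewrite exprD; ring.
Qed.

Lemma resprod_mull (f f' g : {poly int}) : f != 0 -> f' != 0 -> g != 0 ->
  resprod R (f * f') g = resprod R f g * resprod R f' g.
Proof.
move=> f0 f'0 g0; apply: polyZC_inj.
rewrite polyZCM !polyZC_resprod ?mulf_neq0 // polyZCM.
by rewrite resprodC_mull ?polyZC_eq0.
Qed.

(** The only roots are [a' / a] and [b' / b]; the leading constant [a * b] clears the denominators
    of their product. *)
Lemma resprod_linear (a a' b b' : int) : a != 0 -> b != 0 ->
  resprod R (a *: 'X - a'%:P) (b *: 'X - b'%:P) = (a * b) *: 'X - (a' * b')%:P.
Proof.
move=> a0 b0.
have lin (c c' : int) : c != 0 -> [/\ polyZC R (c *: 'X - c'%:P) =
    c%:~R *: 'X - c'%:~R%:P, size (c *: 'X - c'%:P) = 2%N &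
    lead_coef (c *: 'X - c'%:P) = c].
  move=> c0; split.
  - by rewrite /polyZC rmorphB /= map_polyZ map_polyX map_polyC.
  - by rewrite size_polyDl size_scale ?size_polyX // size_polyN ltnS size_polyC_leq1.
  - by rewrite lead_coefDl ?lead_coefZ ?lead_coefX ?mulr1 // size_polyN
      size_scale ?size_polyX // ltnS size_polyC_leq1.
have rts (c c' : int) : c != 0 ->
    rootsC (polyZC R (c *: 'X - c'%:P)) = [:: c'%:~R / c%:~R].
  move=> c0; apply/perm_small_eq => //.
  have cR : c%:~R != 0 :> R[i] by rewrite intr_eq0.
  apply: (rootsC_perm _ _ _ cR); rewrite big_seq1.
  have [-> _ _] := lin _ c' c0.
  by rewrite scalerBr -[_ *: _%:P]mul_polyC -polyCM mulrCA mulfV ?mulr1.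
have [ea sa la] := lin _ a' a0; have [eb sb lb] := lin _ b' b0.
have [eab _ _] := lin _ (a' * b') (mulf_neq0 a0 b0).
apply: polyZC_inj; rewrite polyZC_resprod -?size_poly_gt0 ?sa ?sb // eab.
rewrite /resprodC !rts // !big_seq1 !lead_coef_polyZC !size_polyZC sa sb la lb.
rewrite /= !expr1 -intrM scalerBr; congr (_ - _).
rewrite -[_ *: _%:P]mul_polyC -polyCM !intrM; congr _%:P.
by field; rewrite !intr_eq0 a0 b0.
Qed.

Lemma size_resprodC (p q : {poly R[i]}) : p != 0 -> q != 0 ->
  size (resprodC p q) = ((size p).-1 * (size q).-1).+1.
Proof.
move=> p0 q0; rewrite /resprodC size_scale; last first.
  by rewrite mulf_neq0 ?expf_neq0 ?lead_coef_eq0.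
rewrite -!size_rootsC //; set s := rootsC q.
have -> : \prod_(x <- rootsC p) \prod_(y <- s) ('X - (x * y)%:P) =
    \prod_(z <- [seq x * y | x <- rootsC p, y <- s]) ('X - z%:P).
  by rewrite big_allpairs_dep.
by rewrite size_prod_XsubC size_allpairs.
Qed.

Lemma size_resprod (f g : {poly int}) : f != 0 -> g != 0 ->
  size (resprod R f g) = ((size f).-1 * (size g).-1).+1.
Proof.
move=> f0 g0; rewrite -size_polyZC polyZC_resprod // size_resprodC ?polyZC_eq0 //.
by rewrite !size_polyZC.
Qed.

End Resprod.

(** * Height and decay bounds *)

(** Each term of the Leibniz expansion contains exactly one entry of column 0, which supplies the
    factor [eps]. *)
Lemma normr_det_le {A : realDomainType} (N : nat) (M : 'M[A]_N.+1)
    (r : 'I_N.+1 -> A) (eps : A) :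
  0 <= eps -> (forall i j, j != 0 -> `|M i j| <= r i) ->
  (forall i, `|M i 0| <= eps * r i) ->
  `|\det M| <= (N.+1)`!%:R * (eps * \prod_i r i).
Proof.
move=> eps0 hr h0; rewrite /determinant.
apply: (le_trans (ler_norm_sum _ _ _)).
rewrite (_ : (N.+1)`! = #|{perm 'I_N.+1}|); last by rewrite card_Sn.
rewrite mulr_natl -sumr_const; apply: ler_sum => s _.
rewrite normrM normr_sign mul1r normr_prod.
(* Isolate on both sides the row that [s] sends to column 0. *)
rewrite (bigD1 ((s^-1)%g 0)) //= (bigD1 (P := xpredT) (s^-1 0)%g) //= mulrA permKV.
apply: ler_pM => //; first exact: prodr_ge0.
apply: ler_prod => i; rewrite normr_ge0 /= => ni; apply: hr.
by apply: contraNneq ni => <-; rewrite permK.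
Qed.

(** Each permutation contributes a single monomial, so no convolution of coefficients enters and the
    factorial is the only constant. *)
Lemma coef_det_monomials_le {A : realDomainType} (N : nat) (M : 'M[{poly A}]_N)
    (r : 'I_N -> A) (l : nat) :
  (forall i j, exists c k, M i j = c *: 'X^k /\ `|c| <= r i) ->
  `|(\det M)`_l| <= N`!%:R * \prod_i r i.
Proof.
move=> hM; rewrite /determinant coef_sum.
apply: (le_trans (ler_norm_sum _ _ _)).
rewrite (_ : N`! = #|{perm 'I_N}|); last by rewrite card_Sn.
rewrite mulr_natl -sumr_const; apply: ler_sum => s _.
have [c [k [-> hc]]] : exists c k,
    \prod_i M i (s i) = c *: 'X^k /\ `|c| <= \prod_i r i.
  elim/big_rec2: _ => [|i y p _ [c [k [-> hc]]]].
    by exists 1, 0; rewrite scale1r normr1.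
  have [c' [k' [-> hc']]] := hM i (s i).
  exists (c' * c), (k' + k)%N; rewrite -scalerAl -scalerAr scalerA exprD; split=> //.
  by rewrite normrM; apply: ler_pM.
rewrite -signr_odd -scalerAr coefZ; case: odd; rewrite ?expr1 ?expr0.
  rewrite mulN1r coefN coefXn normrM normrN.
  by case: eqP => _; rewrite ?normr1 ?mulr1 // normr0 mulr0 (le_trans _ hc).
rewrite mul1r coefXn normrM.
by case: eqP => _; rewrite ?normr1 ?mulr1 // normr0 mulr0 (le_trans _ hc).
Qed.

Lemma prod_if_ltn {A : comNzRingType} (m n : nat) (a b : A) :
  \prod_(i < m + n) (if (i < m)%N then b else a) = b ^+ m * a ^+ n.
Proof.
rewrite big_split_ord /=; congr (_ * _).
  under eq_bigr do rewrite ltn_ord.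
  by rewrite prodr_const card_ord.
under eq_bigr do rewrite ltnNge leq_addr /=.
by rewrite prodr_const card_ord.
Qed.

(** As polynomials in [X], the entries are monomials: constants in the rows of [f], some [g_l X^l]
    or 0 in the rows of the homogenisation. *)
Lemma coef_resdet_le {A : realDomainType} (m n : nat) (f g : {poly A})
    (hf hg : A) (l : nat) :
  (forall i, `|f`_i| <= hf) -> (forall i, `|g`_i| <= hg) ->
  `|(resdet m n f g)`_l| <= (m + n)`!%:R * (hg ^+ m * hf ^+ n).
Proof.
move=> bf bg; rewrite -prod_if_ltn; apply: coef_det_monomials_le => i j.
have hf0 : 0 <= hf by apply: le_trans (bf 0%N).
have hg0 : 0 <= hg by apply: le_trans (bg 0%N).
rewrite mxE /syl_row; case: ifP => _; rewrite coefMXn; case: ifP => _.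
- by exists 0, 0; rewrite scale0r normr0.
- rewrite coef_poly; case: ifP => _; last by exists 0, 0; rewrite scale0r normr0.
  by do 2!eexists; split; first by [].
- by exists 0, 0; rewrite scale0r normr0.
- by rewrite coef_map /=; exists f`_(j - (i - m)), 0; rewrite expr0 alg_polyC.
Qed.

(** Adding [t^k] times column [k] to column 0, for all [k > 0], preserves the determinant; [V] is
    the matrix of this column operation. *)
Lemma det_coef_horner {A : comNzRingType} (N : nat) (P : 'I_N.+1 -> {poly A})
    (t : A) :
  (forall i, size (P i) <= N.+1)%N ->
  \det (\matrix_(i, j < N.+1) (P i)`_j)
  = \det (\matrix_(i, j < N.+1) if j == 0 then (P i).[t] else (P i)`_j).
Proof.
move=> sP.
pose V : 'M[A]_N.+1 := \matrix_(k, j) if j == 0 then t ^+ k else (k == j)%:R.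
have detV : \det V = 1.
  rewrite det_trig.
    by rewrite big1 // => i _; rewrite mxE eqxx; case: eqP => // ->.
  apply/is_trig_mxP => i j lij; rewrite mxE -!val_eqE /= (ltn_eqF lij).
  by rewrite gtn_eqF // (leq_ltn_trans _ lij).
rewrite -[LHS]mulr1 -detV -det_mulmx; congr (\det _).
apply/matrixP => i j; rewrite !mxE; case: eqP => [->|/eqP j0].
  by rewrite (horner_coef_wide _ (sP i)); apply: eq_bigr => k _; rewrite !mxE eqxx.
rewrite (bigD1 j) //= !mxE (negPf j0) eqxx mulr1 big1 ?addr0 // => k /negPf kj.
by rewrite !mxE (negPf j0) kj mulr0.
Qed.

Lemma horner_resdet {A : comNzRingType} (m n : nat) (f g : {poly A}) (x : A) :
  (resdet m n f g).[x]
  = \det (syl m n f (\poly_(l < n.+1) (g`_(n - l) * x ^+ (n - l)))).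
Proof.
rewrite -horner_evalE /resdet -det_map_mx; congr (\det _).
apply/matrixP => i j; rewrite !mxE /= horner_evalE /syl_row.
case: ifP => _; rewrite !coefMXn; case: ifP => _; rewrite ?horner0 //.
  by rewrite !coef_poly; case: ifP => _; rewrite ?horner0 // hornerZ hornerXn.
by rewrite coef_map /= hornerC.
Qed.

(** Since [(x y)^l x^(n - l) = x^n y^l], the rows built from [g] are multiples of [g.[y]] at
    [Y = x], hence small. *)
Lemma horner_homogenize_mul {A : comNzRingType} (n : nat) (g : {poly A})
    (x y : A) :
  (size g <= n.+1)%N ->
  (\poly_(l < n.+1) (g`_(n - l) * (x * y) ^+ (n - l))).[x] = x ^+ n * g.[y].
Proof.
move=> sg; rewrite horner_poly (horner_coef_wide _ sg) mulr_sumr.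
rewrite (reindex_inj rev_ord_inj) /=; apply: eq_bigr => l _.
rewrite subSS subKn; last by rewrite -ltnS.
have -> : x ^+ n = x ^+ l * x ^+ (n - l) by rewrite -exprD subnKC // -ltnS.
by rewrite exprMn; ring.
Qed.

(* Replacing the first column by the values of the rows at [x] makes each term
   of the determinant contain one of the small values [f.[x]] or [g.[y]]. *)
Lemma horner_resdet_le {A : realDomainType} (m n : nat) (x y : A) :
  (0 < m)%N ->
  exists2 K : A, 0 <= K & forall (f g : {poly A}) (hf hg eps : A),
    (size f <= m.+1)%N -> (size g <= n.+1)%N -> 0 <= eps ->
    (forall i, `|f`_i| <= hf) -> (forall i, `|g`_i| <= hg) ->
    `|f.[x]| <= eps * hf -> `|g.[y]| <= eps * hg ->
    `|(resdet m n f g).[x * y]| <= K * (eps * (hg ^+ m * hf ^+ n)).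
Proof.
case: m => // m _.
(* [k] is at least 1 and dominates both points, so [k ^+ N] bounds all their powers up to [N]. *)
pose k := 1 + `|x| + `|x * y|; pose N := (m.+1 + n)%N.
have k1 : 1 <= k by rewrite /k -addrA lerDl addr_ge0.
have xk : `|x| <= k by rewrite /k -addrA addrCA lerDl addr_ge0.
have xyk : `|x * y| <= k by rewrite /k lerDr addr_ge0.
have kX i j (z : A) : (i <= j)%N -> `|z| <= k -> `|z| ^+ i <= k ^+ j.
  move=> ij zk; apply: (@le_trans _ _ (k ^+ i)); last by rewrite ler_weXn2l.
  by apply: lerXn2r => //; rewrite nnegrE // (le_trans ler01).
have k0 i : 0 <= k ^+ i by rewrite exprn_ge0 // (le_trans ler01).
(* One factor [k ^+ N] for each of the [N] rows, and [N!] terms. The constant does not depend on [f]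
   and [g], so it serves for all components of an ultrapower element at once. *)
exists (N`!%:R * (k ^+ N) ^+ N).
  by rewrite mulr_ge0 // exprn_ge0.
move=> f g hf hg eps sf sg eps0 bf bg fx gy.
have hf0 : 0 <= hf by apply: le_trans (bf 0%N).
have hg0 : 0 <= hg by apply: le_trans (bg 0%N).
rewrite horner_resdet; set q := \poly_(_ < _) _.
have sq : (size q <= n.+1)%N by exact: size_poly.
rewrite /syl (@det_coef_horner _ (m + n) (fun i => syl_row m.+1 f q i) x); last first.
  by move=> i; apply: (@size_syl_row _ m.+1).
pose r (i : 'I_N) := k ^+ N * (if (i < m.+1)%N then hg else hf).
have -> : N`!%:R * (k ^+ N) ^+ N * (eps * (hg ^+ m.+1 * hf ^+ n))
    = N`!%:R * (eps * \prod_i r i).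
  rewrite big_split /= prodr_const card_ord prod_if_ltn; ring.
have h0 (i : nat) : (i < N)%N -> `|(syl_row m.+1 f q i).[x]| <=
    eps * (k ^+ N * (if (i < m.+1)%N then hg else hf)).
  rewrite /syl_row => ltiN; case: ltnP => him.
    rewrite hornerM hornerXn horner_homogenize_mul // mulrAC -exprD normrM normrX.
    rewrite mulrCA; apply: ler_pM; rewrite ?exprn_ge0 //.
    by apply: kX => //; rewrite /N; lia.
  rewrite hornerM hornerXn normrM normrX mulrC mulrCA.
  by apply: ler_pM; rewrite ?exprn_ge0 //; apply: kX => //; rewrite /N; lia.
apply: normr_det_le => // i; last by rewrite mxE eqxx h0.
move=> j j0; rewrite mxE (negPf j0) /r /syl_row; case: ltnP => him; rewrite coefMXn.
  case: ifP => _; first by rewrite normr0 mulr_ge0.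
  rewrite coef_poly; case: ifP => _; last by rewrite normr0 mulr_ge0.
  rewrite normrM normrX mulrC; apply: ler_pM; rewrite ?exprn_ge0 //; apply: kX => //.
  by apply: (leq_trans (leq_subr _ _)); rewrite /N; lia.
case: ifP => _; first by rewrite normr0 mulr_ge0.
by apply: (le_trans (bf _)); rewrite ler_peMl // exprn_ege1.
Qed.

(** * Ultrapowers *)

Section Ultra.
Variable U : npultra.

Lemma usets_forall_lt (A : nat -> set nat) (N : nat) :
  (forall i, (i < N)%N -> U (A i)) -> U [set n | forall i, (i < N)%N -> A i n].
Proof.
elim: N => [|N IHN] hA; first exact: usetsT.
have hN : U [set n | forall i, (i < N)%N -> A i n].
  by apply: IHN => i iN; apply: hA; rewrite ltnS ltnW.
apply: usetsS (usetsI hN (hA _ (ltnSn N))) => n /= [h hn] i.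
by rewrite ltnS leq_eqVlt => /orP[/eqP ->|/h].
Qed.

Lemma umkD (S : zmodType) (s t : nat -> S) :
  umk s + umk t = umk (fun n => s n + t n) :> ustar U S.
Proof. exact: umap2E. Qed.

Lemma umkN (S : zmodType) (s : nat -> S) :
  - umk s = umk (fun n => - s n) :> ustar U S.
Proof. exact: umapE. Qed.

Lemma umkM (S : comNzRingType) (s t : nat -> S) :
  umk s * umk t = umk (fun n => s n * t n) :> ustar U S.
Proof. exact: umap2E. Qed.

Lemma umkX (S : comNzRingType) (s : nat -> S) (k : nat) :
  umk s ^+ k = umk (fun n => s n ^+ k) :> ustar U S.
Proof.
elim: k => [|k IHk]; first by apply/umkP/usetsT.
by rewrite exprS IHk umkM; apply/umkP/usetsT => n /=; rewrite exprS.
Qed.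

Lemma umk_sum (S : zmodType) (N : nat) (s : nat -> nat -> S) :
  \sum_(i < N) umk (s i) = umk (fun n => \sum_(i < N) s i n) :> ustar U S.
Proof.
elim: N => [|N IHN].
  by rewrite big_ord0; apply/umkP/usetsT => n /=; rewrite big_ord0.
rewrite big_ord_recr /= IHN umkD; apply/umkP/usetsT => n /=.
by rewrite big_ord_recr.
Qed.

Lemma umk_le (S : realDomainType) (s t : nat -> S) :
  (umk s <= umk t :> ustar U S) <-> U [set n | s n <= t n].
Proof. exact: uleE. Qed.

Lemma umk_lt (S : realDomainType) (s t : nat -> S) :
  (umk s < umk t :> ustar U S) <-> U [set n | s n < t n].
Proof.
rewrite ltNge; split=> [/negP h|h].
  have /usetsC : ~ U [set n | t n <= s n] by move=> /umk_le.
  by apply: usetsS => n /= /negP; rewrite -ltNge.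
apply/negP => /umk_le h'; apply: (@usets0 U).
by apply: usetsS (usetsI h h') => n /= [h1 h2]; rewrite ltNge h2 in h1.
Qed.

Lemma umk_norm (S : realDomainType) (s : nat -> S) :
  `|umk s| = umk (fun n => `|s n|) :> ustar U S.
Proof. exact: umapE. Qed.

(** * Polynomials over the ultrapower and their components *)

Implicit Types F G : {poly ustar U int}.

(** A nonzero leading coefficient in the ultrapower has nonzero components almost everywhere. *)
Lemma size_pcomp F : U [set n | size (pcomp F n) = size F].
Proof.
have [F0|Fn0] := eqVneq F 0.
  apply: usetsT => n /=; apply/eqP; rewrite eqn_leq size_poly /=.
  by rewrite F0 size_poly0.
have : ~ U [set n | urep F`_(size F).-1 n = 0].
  move=> h; move: Fn0; rewrite -lead_coef_eq0 /lead_coef => /eqP; apply.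
  by rewrite -[LHS]urepK; apply/umkP.
move=> /usetsC; apply: usetsS => n /= /eqP h.
by rewrite size_poly_eq.
Qed.

Lemma pcomp_neq0 F : F != 0 -> U [set n | pcomp F n != 0].
Proof.
move=> F0; apply: usetsS (size_pcomp F) => n /= sn.
by rewrite -size_poly_gt0 sn size_poly_gt0.
Qed.

(** Each coefficient agrees on a set of the ultrafilter that depends on its index; the common degree
    bound leaves finitely many indices, and these sets can be intersected. *)
Lemma represents_pcompE (f : nat -> {poly int}) F :
  represents f F -> U [set n | f n = pcomp F n].
Proof.
move=> [[N hN] hf]; pose M := maxn N (size F).
have h i : (i < M)%N -> U [set n | (f n)`_i = (pcomp F n)`_i].
  by move=> _; apply/umkP; rewrite -hf (represents_pcomp F).2.
apply: usetsS (usetsI hN (usets_forall_lt _ _ h)) => n /= [sf hi].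
apply/polyP => i; case: (ltnP i M) => [/hi //|].
rewrite geq_max => /andP[Ni Fi].
rewrite nth_default ?(leq_trans sf) // nth_default //.
by rewrite (leq_trans (size_poly _ _)).
Qed.

Lemma represents_inj (f g : nat -> {poly int}) F G :
  U [set n | f n = g n] -> represents f F -> represents g G -> F = G.
Proof.
move=> fg [_ hf] [_ hg]; apply/polyP => i; rewrite hf hg; apply/umkP.
by apply: usetsS fg => n /= ->.
Qed.

Lemma representsM (f g : nat -> {poly int}) F G :
  represents f F -> represents g G ->
  represents (fun n => f n * g n) (F * G).
Proof.
move=> [[N hN] hf] [[M hM] hg]; split.
  exists (N + M)%N; apply: usetsS (usetsI hN hM) => n /= [fN gM].
  apply: (leq_trans (size_polyMleq _ _)); apply: (leq_trans (leq_pred _)).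
  exact: leq_add.
move=> i; rewrite coefM.
under eq_bigr do rewrite hf hg umkM.
rewrite (umk_sum _ _ (fun j n => (f n)`_j * (g n)`_(i - j))).
by apply/umkP/usetsT => n /=; rewrite coefM.
Qed.

Lemma represents_linear (a b : nat -> int) :
  @represents U (fun n => a n *: 'X - (b n)%:P) (umk a *: 'X - (umk b)%:P).
Proof.
split.
  exists 2%N; apply: usetsT => n /=.
  apply: (leq_trans (size_polyD _ _)); rewrite geq_max size_polyN.
  rewrite (leq_trans (size_scale_leq _ _)) ?size_polyX //=.
  by rewrite (leq_trans (size_polyC_leq1 _)).
move=> i; rewrite coefB coefZ coefX coefC.
have {1}-> : (i == 1%N)%:R = umk (fun=> (i == 1%N)%:R) :> ustar U int.
  by case: eqP => _; apply/umkP/usetsT.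
rewrite umkM; have -> : (if i == 0%N then umk b else 0) =
    umk (fun n => if i == 0%N then b n else 0) :> ustar U int.
  by case: (i == 0%N); apply/umkP/usetsT.
rewrite umkN umkD; apply/umkP/usetsT => n /=.
by rewrite coefB coefZ coefX coefC.
Qed.

Section RealType.
Variable R : realType.

(** Independence of representatives. Almost everywhere the components have the degrees of [F] and
    [G], so the product has the degree at which [uresprod] truncates, and nothing is lost. *)
Lemma represents_uresprod F G (f g : nat -> {poly int}) :
  F != 0 -> G != 0 -> represents f F -> represents g G ->
  represents (fun n => resprod R (f n) (g n)) (uresprod R F G).
Proof.
move=> F0 G0 rf rg.
have fF := represents_pcompE _ _ rf; have gG := represents_pcompE _ _ rg.
have sz : U [set n | (size (resprod R (f n) (g n)) <=
    ((size F).-1 * (size G).-1).+1)%N].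
  apply: usetsS (usetsI (usetsI fF gG) (usetsI (usetsI (pcomp_neq0 _ F0)
    (pcomp_neq0 _ G0)) (usetsI (size_pcomp F) (size_pcomp G)))) => n /=.
  move=> [[-> ->] [[f0 g0] [sf sg]]].
  by rewrite size_resprod // sf sg.
split; first by eexists; exact: sz.
move=> i; rewrite coef_poly; case: ltnP => hi; apply/umkP.
  by apply: usetsS (usetsI fF gG) => n /= [-> ->].
by apply: usetsS sz => n /= sn; rewrite nth_default // (leq_trans sn).
Qed.

Lemma uresprod_mull F F' G : F != 0 -> F' != 0 -> G != 0 ->
  uresprod R (F * F') G = uresprod R F G * uresprod R F' G.
Proof.
move=> F0 F'0 G0.
have rF := represents_pcomp F; have rF' := represents_pcomp F'.
have rG := represents_pcomp G.
apply: (represents_inj _ _ _ _ _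
  (represents_uresprod _ _ _ _ (mulf_neq0 F0 F'0) G0 (representsM _ _ _ _ rF rF') rG)
  (representsM _ _ _ _ (represents_uresprod _ _ _ _ F0 G0 rF rG)
     (represents_uresprod _ _ _ _ F'0 G0 rF' rG))).
apply: usetsS (usetsI (pcomp_neq0 _ F0) (usetsI (pcomp_neq0 _ F'0)
  (pcomp_neq0 _ G0))) => n /= [f0 [f'0 g0]].
exact: resprod_mull.
Qed.

Lemma uresprodC F G : uresprod R F G = uresprod R G F.
Proof.
rewrite /uresprod mulnC; apply/polyP => i; rewrite !coef_poly; case: ifP => // _.
by apply/umkP/usetsT => n /=; rewrite resprod_comm.
Qed.

Lemma uresprod_linear (m m' n n' : ustar U int) : m != 0 -> n != 0 ->
  uresprod R (m *: 'X - m'%:P) (n *: 'X - n'%:P) = (m * n) *: 'X - (m' * n')%:P.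
Proof.
have [a ->] := umk_surj m; have [a' ->] := umk_surj m'.
have [b ->] := umk_surj n; have [b' ->] := umk_surj n' => a0 b0.
have lin0 (c c' : ustar U int) : c != 0 -> c *: 'X - c'%:P != 0.
  move=> c0; rewrite -size_poly_gt0 size_polyDl size_scale ?size_polyX //.
  by rewrite size_polyN ltnS size_polyC_leq1.
rewrite !umkM.
apply: (represents_inj _ _ _ _ _ (represents_uresprod _ _ _ _ (lin0 _ _ a0)
  (lin0 _ _ b0) (represents_linear a a') (represents_linear b b'))
  (represents_linear _ _)).
have nz (c : nat -> int) : umk c != 0 :> ustar U int -> U [set n | c n != 0].
  move=> /eqP c0; have /usetsC : ~ U [set n | c n = 0] by move=> /umkP.
  by apply: usetsS => k /= /eqP.
apply: usetsS (usetsI (nz _ a0) (nz _ b0)) => k /= [ak bk].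
exact: resprod_linear.
Qed.

Lemma ueval_umk (f : nat -> {poly int}) F (t : R) : represents f F ->
  ueval F t = umk (fun n => (map_poly (intr : int -> R) (f n)).[t]).
Proof.
move=> rf; rewrite /ueval /map_poly horner_poly.
under eq_bigr do rewrite (represents_pcomp F).2 /starZR umapE /ustd umkX umkM.
rewrite (umk_sum _ _ (fun i n => ((pcomp F n)`_i)%:~R * t ^+ i)).
apply/umkP.
apply: usetsS (usetsI (represents_pcompE _ _ rf) (size_pcomp F)) => n /= [-> sn].
by rewrite horner_poly sn.
Qed.

(** * Infinitesimals, orders of magnitude, heights, growth and decay in components *)

Lemma infinitesimal_umk (s : nat -> R) :
  infinitesimal (umk s : ustar U R) <->
  forall c, 0 < c -> U [set n | `|s n| < c].
Proof.
by split=> h c c0; have := h c c0; rewrite umk_norm => /umk_lt.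
Qed.

(** Changing representatives multiplies by finite units [u] and [v], and [u / v] is bounded by a
    standard real. *)
Lemma prle_prcls (x y : ustar U R) : 0 <= x -> 0 <= y ->
  prle (prcls x) (prcls y) -> exists2 c, 0 < c & x <= ustd c * y.
Proof.
move=> x0 y0 [x' [y' [x'0 y'0 /prclsP[u fu]]]].
rewrite !ger0_norm // => xE /prclsP[v fv]; rewrite !ger0_norm // => yE x'y'.
have v0 := finunit_pos_gt0 fv; have u0 := finunit_pos_gt0 fu.
have /finunit_posP[a [b [a0 ab bb]]] := finunit_posM fu (finunit_posV fv).
exists b.
  have : ustd a <= ustd b :> ustar U R by apply: le_trans bb.
  move=> /umk_le h; rewrite ltNge; apply/negP => b0; apply: (@usets0 U).
  by apply: usetsS h => n /=; rewrite leNgt (le_lt_trans b0 a0).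
rewrite xE; apply: (@le_trans _ _ (u * y')); first by rewrite ler_pM2l.
have -> : u * y' = u * v^-1 * y by rewrite yE mulrA mulfVK // gt_eqF.
by rewrite ler_wpM2r.
Qed.

(** If [x] were at least a standard multiple of [y], then [x / y] would be a finite unit and the
    classes equal. Conversely, [y = u * x] with [u] at most a standard [b] contradicts the bound for
    [c = b^-1]. *)
Lemma prlt_prcls (x y : ustar U R) : 0 <= x -> 0 < y ->
  prlt (prcls x) (prcls y) <-> forall c, 0 < c -> x < ustd c * y.
Proof.
move=> x0 y0; split.
  move=> [le_xy ne] c c0; have [b b0 xb] := prle_prcls _ _ x0 (ltW y0) le_xy.
  rewrite ltNge; apply/negP => cx; apply: ne; apply/esym/prclsP.
  exists (x / y); last by rewrite !ger0_norm ?(ltW y0) // mulfVK // gt_eqF.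
  apply/finunit_posP; exists c, b; split=> //.
    by rewrite ler_pdivlMr.
  by rewrite ler_pdivrMr.
move=> h; split.
  exists x, y; split=> //; first exact: ltW.
  have := h _ ltr01; rewrite (_ : ustd 1 = 1) // mul1r; exact: ltW.
move=> /prclsP[u /finunit_posP[a [b [a0 au ub]]]].
rewrite !ger0_norm ?(ltW y0) // => yE.
have b0 : 0 < b.
  rewrite ltNge; apply/negP => b0.
  have : ustd b <= 0 :> ustar U R by apply/umk_le/usetsT.
  by apply/negP; rewrite -ltNge (lt_le_trans _ ub) // (lt_le_trans _ au) // ustd_gt0.
have : y < y; last by rewrite ltxx.
have bi : 0 < b^-1 by rewrite invr_gt0.
rewrite {1}yE (le_lt_trans (ler_wpM2r x0 ub)) //.
by have := h _ bi; rewrite ustdV // ltr_pdivlMl // ustd_gt0.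
Qed.

Lemma prexp_prcls (x : ustar U R) (k : nat) :
  prexp (prcls x) k = prcls (x ^+ k).
Proof.
by rewrite /prexp; elim: k => [//|k IHk] /=; rewrite IHk prmulE exprS.
Qed.

Lemma height_ge F (i : nat) : `|F`_i| <= height F.
Proof.
case: (ltnP i (size F)) => hi; last first.
  rewrite nth_default // normr0 /height.
  by elim/big_rec: _ => // k x _ x0; rewrite le_max x0 orbT.
by rewrite /height (bigD1 (Ordinal hi)) //= le_max lexx.
Qed.

Lemma height_attained F : exists i, height F = `|F`_i|.
Proof.
rewrite /height; elim/big_rec: _ => [|k x _ [i ->]].
  (* The initial value 0 of the maximum is itself a coefficient, past the degree. *)
  by exists (size F); rewrite nth_default // normr0.
by rewrite /Order.max; case: ifP => _; eexists.
Qed.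

(** The lower bound 1 comes from integrality of the leading coefficient; it later allows exponents
    of heights to be raised from the degrees to [d] and [e]. *)
Lemma height_pcomp F (k : nat -> int) : F != 0 -> height F = umk k ->
  U [set n | [/\ 1 <= k n & forall i, `|(pcomp F n)`_i| <= k n]].
Proof.
move=> F0 hk.
have h i : (i < size F)%N -> U [set n | `|(pcomp F n)`_i| <= k n].
  move=> _; apply/umk_le; rewrite -hk -umk_norm -(represents_pcomp F).2.
  exact: height_ge.
apply: usetsS (usetsI (usets_forall_lt _ _ h) (usetsI (size_pcomp F)
  (pcomp_neq0 _ F0))) => n /= [hi [sn f0]].
have k1 : 1 <= k n.
  have sF : ((size F).-1 < size F)%N by rewrite prednK // size_poly_gt0.
  apply: le_trans (hi _ sF); rewrite -sn -/(lead_coef _).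
  by rewrite -gtz0_ge1 normr_gt0 lead_coef_eq0.
split=> // i; case: (ltnP i (size F)) => [/hi //|iF].
by rewrite nth_default ?sn // normr0 (le_trans _ k1).
Qed.

Lemma growth_umk (D : nat) F (k : nat -> int) : height F = umk k ->
  growth R D F = prcls (umk (fun n => (k n)%:~R `^ (- D%:R^-1))).
Proof. by move=> hk; rewrite /growth hk /starZR !umapE. Qed.

Lemma powR_invnX (D : nat) (x : R) : (0 < D)%N -> 0 <= x ->
  (x `^ D%:R^-1) ^+ D = x.
Proof.
move=> D0 x0; rewrite -powR_mulrn ?powR_ge0 // -powRrM mulVf ?powRr1 //.
by rewrite pnatr_eq0 -lt0n.
Qed.

(** Raising to the power [D] removes the root, and [c ^+ D] takes all positive values as [c] does.
    The condition says that [s^D] times the height is infinitesimal. *)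
Lemma lt_growth (D : nat) F (k : nat -> int) (s : nat -> R) :
  (0 < D)%N -> height F = umk k ->
  U [set n | 1 <= k n] -> U [set n | 0 <= s n] ->
  prlt (prcls (umk s)) (growth R D F) <->
  forall c, 0 < c -> U [set n | s n ^+ D * (k n)%:~R < c].
Proof.
move=> D0 hk k1 s0; rewrite (growth_umk _ _ _ hk).
have kR n : 1 <= k n -> 0 < (k n)%:~R :> R by move=> h; rewrite ltr0z gtz0_ge1.
rewrite prlt_prcls; last 2 first.
- exact/umk_le.
- by apply/umk_lt; apply: usetsS k1 => n /= /kR h; rewrite powR_gt0.
have E (c : R) : 0 < c ->
    (umk s < ustd c * umk (fun n => (k n)%:~R `^ (- D%:R^-1)) :> ustar U R) <->
    U [set n | s n ^+ D * (k n)%:~R < c ^+ D].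
  move=> c0; rewrite umkM umk_lt.
  have pt n : 1 <= k n -> 0 <= s n -> (s n < c * (k n)%:~R `^ (- D%:R^-1)) =
      (s n ^+ D * (k n)%:~R < c ^+ D).
    move=> /kR kn sn; rewrite powRN ltr_pdivlMr ?powR_gt0 //.
    rewrite -[in RHS](@powR_invnX D (k n)%:~R) ?(ltW kn) // -exprMn.
    by rewrite ltr_pXn2r // nnegrE ?(ltW c0) // mulr_ge0 ?powR_ge0.
  split=> h; apply: usetsS (usetsI h (usetsI k1 s0)) => n /= [hn [kn sn]];
    by rewrite ?pt // -pt.
split=> h c c0; last by apply/E => //; apply: h; rewrite exprn_gt0.
have c'0 : 0 < c `^ D%:R^-1 by rewrite powR_gt0.
by have /(E _ c'0) := h _ c'0; rewrite powR_invnX // ltW.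
Qed.

Lemma le_decay (D : nat) (t : R) F (w : nat -> R) :
  (0 < D)%N -> U [set n | 0 <= w n] ->
  prle (decay D t F) (prcls (umk w)) ->
  exists2 C, 0 < C & U [set n |
    `|(map_poly (intr : int -> R) (pcomp F n)).[t]| <= C * w n ^+ D].
Proof.
move=> D0 w0; rewrite /decay (ueval_umk _ _ _ (represents_pcomp F)) umk_norm umapE.
move=> /prle_prcls[||c c0].
- by apply/umk_le/usetsT => n /=; rewrite powR_ge0.
- exact/umk_le.
rewrite umkM => /umk_le h; exists (c ^+ D); first by rewrite exprn_gt0.
apply: usetsS (usetsI h w0) => n /= [hn wn].
rewrite -[leLHS](@powR_invnX D) // -exprMn; apply: lerXn2r => //.
  by rewrite nnegrE powR_ge0.
by rewrite nnegrE mulr_ge0 // ltW.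
Qed.

End RealType.
End Ultra.

(** * The approximate ideal product *)

(** This is an equality for [m = d] and [n = e]; heights at least 1 give the other cases. *)
Lemma growth_estimate {K : realFieldType} (d e m n : nat) (s t hf hg : K) :
  0 <= s -> 0 <= t -> 1 <= hf -> 1 <= hg -> (m <= d)%N -> (n <= e)%N ->
  (s * t) ^+ (d * e) * (hg ^+ m * hf ^+ n)
  <= (s ^+ d * hf) ^+ e * (t ^+ e * hg) ^+ d.
Proof.
move=> s0 t0 f1 g1 md ne.
have f0 : 0 <= hf by apply: le_trans f1.
have g0 : 0 <= hg by apply: le_trans g1.
have -> : (s ^+ d * hf) ^+ e * (t ^+ e * hg) ^+ d =
    (s * t) ^+ (d * e) * (hg ^+ d * hf ^+ e).
  by rewrite !exprMn -!exprM [(e * d)%N]mulnC; ring.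
apply: ler_wpM2l; first by rewrite exprn_ge0 // mulr_ge0.
by apply: ler_pM; rewrite ?exprn_ge0 // ler_weXn2l.
Qed.

(** Dividing by a height removes one of its factors. The decay exponents are those that complete the
    remaining [hg^(d+1) hf^e] and [hg^d hf^(e+1)] to powers of [a] and [b]. Here the degree bounds
    are [d.+1] and [e.+1]. *)
Lemma decay_estimate {K : realFieldType} (d e m n : nat)
    (s t hf hg x y C C' : K) :
  0 <= s -> 0 <= t -> 1 <= hf -> 1 <= hg -> (m < d.+1)%N -> (n < e.+1)%N ->
  0 <= x -> 0 <= y -> 0 <= C -> 0 <= C' ->
  x <= C * (s ^+ e * t ^+ e.+1) ^+ d.+1 ->
  y <= C' * (s ^+ d.+1 * t ^+ d) ^+ e.+1 ->
  (x / hf + y / hg) * (hg ^+ m.+1 * hf ^+ n.+1)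
  <= C * ((s ^+ d.+1 * hf) ^+ e * (t ^+ e.+1 * hg) ^+ d.+1)
     + C' * ((s ^+ d.+1 * hf) ^+ e.+1 * (t ^+ e.+1 * hg) ^+ d).
Proof.
move=> s0 t0 f1 g1 md ne x0 y0 C0 C'0 hx hy.
set a := s ^+ d.+1 * hf; set b := t ^+ e.+1 * hg.
have f0 : 0 < hf by apply: lt_le_trans f1.
have g0 : 0 < hg by apply: lt_le_trans g1.
have -> : (x / hf + y / hg) * (hg ^+ m.+1 * hf ^+ n.+1) =
    x * (hg ^+ m.+1 * hf ^+ n) + y * (hg ^+ m * hf ^+ n.+1).
  by rewrite !exprS; field; rewrite !gt_eqF.
have st : 0 <= s ^+ e * t ^+ e.+1 by rewrite mulr_ge0 ?exprn_ge0.
have st' : 0 <= s ^+ d.+1 * t ^+ d by rewrite mulr_ge0 ?exprn_ge0.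
apply: lerD.
  have -> : C * (a ^+ e * b ^+ d.+1) =
      C * (s ^+ e * t ^+ e.+1) ^+ d.+1 * (hg ^+ d.+1 * hf ^+ e).
    by rewrite !exprMn -!exprM [(d.+1 * e)%N]mulnC; ring.
  apply: ler_pM => //; first by rewrite mulr_ge0 // exprn_ge0 // ltW.
  by apply: ler_pM; rewrite ?exprn_ge0 ?(ltW f0) ?(ltW g0) // ler_weXn2l.
have -> : C' * (a ^+ e.+1 * b ^+ d) =
    C' * (s ^+ d.+1 * t ^+ d) ^+ e.+1 * (hg ^+ d * hf ^+ e.+1).
  by rewrite !exprMn -!exprM [(e.+1 * d)%N]mulnC; ring.
apply: ler_pM => //; first by rewrite mulr_ge0 // exprn_ge0 // ltW.
by apply: ler_pM; rewrite ?exprn_ge0 ?(ltW f0) ?(ltW g0) // ler_weXn2l.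
Qed.

Section Main.
Variables (R : realType) (U : npultra).

Lemma map_resprod (f g : {poly int}) : f != 0 -> g != 0 ->
  map_poly (intr : int -> R) (resprod R f g) =
  resdet (size f).-1 (size g).-1 (map_poly intr f) (map_poly intr g).
Proof.
move=> f0 g0; rewrite resprodE //.
exact: (map_resdet (GRing.RMorphism.clone _ _ (intr : int -> R) _)).
Qed.

Lemma uresprod_Zmu (theta eta : R) (d e : nat) (mu nu : PR U R)
    (F G : {poly ustar U int}) :
  (0 < d)%N -> (0 < e)%N -> PReps mu -> PReps nu ->
  (1 < size F)%N -> (1 < size G)%N ->
  Zmunu mu (prmul (prexp mu e.-1) (prexp nu e)) theta d F ->
  Zmunu nu (prmul (prexp mu d) (prexp nu d.-1)) eta e G ->
  Zmu (prmul mu nu) (theta * eta) (d * e) (uresprod R F G).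
Proof.
move=> d0 e0 [x [x0 _ ->]] [y [y0 _ ->]] F1 G1.
have Fn0 : F != 0 by rewrite -size_poly_gt0 ltnW.
have Gn0 : G != 0 by rewrite -size_poly_gt0 ltnW.
have [s xE] := umk_surj x; have [t yE] := umk_surj y; subst x y.
have s0 : U [set n | 0 <= s n].
  by move/umk_lt: x0; apply: usetsS => n /= /ltW.
have t0 : U [set n | 0 <= t n].
  by move/umk_lt: y0; apply: usetsS => n /= /ltW.
rewrite !prexp_prcls !prmulE !umkX !umkM.
move=> [[sF _ grF] decF] [[sG _ grG] decG].
have [kf hkf] := umk_surj (height F); have [kg hkg] := umk_surj (height G).
have hF := height_pcomp _ _ _ Fn0 hkf; have hG := height_pcomp _ _ _ Gn0 hkg.
have kf1 : U [set n | 1 <= kf n] by apply: usetsS hF => n /= [].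
have kg1 : U [set n | 1 <= kg n] by apply: usetsS hG => n /= [].
have {}grF := (lt_growth _ _ _ _ _ _ d0 hkf kf1 s0).1 grF.
have {}grG := (lt_growth _ _ _ _ _ _ e0 hkg kg1 t0).1 grG.
have w0 i j : U [set n | 0 <= s n ^+ i * t n ^+ j].
  by apply: usetsS (usetsI s0 t0) => n /= [sn tn]; rewrite mulr_ge0 ?exprn_ge0.
have [C C0 {}decF] := le_decay _ _ _ _ _ _ d0 (w0 _ _) decF.
have [C' C'0 {}decG] := le_decay _ _ _ _ _ _ e0 (w0 _ _) decG.
have szF := size_pcomp _ F; have szG := size_pcomp _ G.
have rH := represents_uresprod _ R _ _ _ _ Fn0 Gn0
  (represents_pcomp F) (represents_pcomp G).
have [m mE] : exists m, size F = m.+2 by case: (size F) F1 => [|[|m]] // _; exists m.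
have [n nE] : exists n, size G = n.+2 by case: (size G) G1 => [|[|n]] // _; exists n.
have md : (m < d)%N by move: sF; rewrite mE.
have ne : (n < e)%N by move: sG; rewrite nE.
pose a k := s k ^+ d * (kf k)%:~R; pose b k := t k ^+ e * (kg k)%:~R.
split.
- apply: (leq_trans (size_poly _ _)); rewrite ltnS.
  by apply: leq_mul; rewrite ?mE ?nE.
- rewrite /infclose subr0 (ueval_umk _ _ _ _ _ rH); apply/infinitesimal_umk => c c0.
  have [K K0 hK] := horner_resdet_le m.+1 n.+1 theta eta (ltn0Sn m).
  (* The added 1 keeps the denominator positive and makes the final inequality strict; the bound by
     1 allows powers of [a] and [b] to be dropped. *)
  pose del := Num.min 1 (c / (K * (C + C') + 1)).
  have KC : 0 < K * (C + C') + 1 by rewrite ltr_wpDl // mulr_ge0 // addr_ge0 // ltW.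
  have del0 : 0 < del by rewrite lt_min ltr01 divr_gt0.
  apply: usetsS (usetsI (usetsI (grF _ del0) (grG _ del0)) (usetsI (usetsI decF decG)
    (usetsI (usetsI hF hG) (usetsI (usetsI s0 t0) (usetsI szF szG))))) => k /=.
  move=> [[]]; rewrite -/(a k) -/(b k) => ak bk.
  move=> [[dF dG] [[[f1 bf] [g1 bg]] [[sk tk] [sf sg]]]].
  have f0 : pcomp F k != 0 by rewrite -size_poly_gt0 sf mE.
  have g0 : pcomp G k != 0 by rewrite -size_poly_gt0 sg nE.
  rewrite map_resprod // sf sg mE nE /=.
  set fR := map_poly intr _ in dF *; set gR := map_poly intr _ in dG *.
  have kf1R : 1 <= (kf k)%:~R :> R by rewrite ler1z.
  have kg1R : 1 <= (kg k)%:~R :> R by rewrite ler1z.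
  have kf0 : 0 < (kf k)%:~R :> R by apply: lt_le_trans kf1R.
  have kg0 : 0 < (kg k)%:~R :> R by apply: lt_le_trans kg1R.
  (* A sum dominating both relative sizes, as the determinant bound requires. *)
  pose eps := `|fR.[theta]| / (kf k)%:~R + `|gR.[eta]| / (kg k)%:~R.
  have bfR i : `|fR`_i| <= (kf k)%:~R by rewrite coef_map /= -intr_norm ler_int.
  have bgR i : `|gR`_i| <= (kg k)%:~R by rewrite coef_map /= -intr_norm ler_int.
  have le1 : `|fR.[theta]| <= eps * (kf k)%:~R.
    by rewrite /eps mulrDl mulfVK ?gt_eqF // lerDl mulr_ge0 ?divr_ge0 // ltW.
  have le2 : `|gR.[eta]| <= eps * (kg k)%:~R.
    by rewrite /eps mulrDl mulfVK ?gt_eqF // lerDr mulr_ge0 ?divr_ge0 // ltW.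
  have eps0 : 0 <= eps by rewrite addr_ge0 ?divr_ge0 // ltW.
  apply: (le_lt_trans (hK fR gR _ _ eps _ _ eps0 bfR bgR le1 le2)).
  + by rewrite size_map_inj_poly ?sf ?mE //; exact: intr_inj.
  + by rewrite size_map_inj_poly ?sg ?nE //; exact: intr_inj.
  have a0 : 0 <= a k by rewrite mulr_ge0 ?exprn_ge0 // ltW.
  have b0 : 0 <= b k by rewrite mulr_ge0 ?exprn_ge0 // ltW.
  have a1 : a k <= 1 by rewrite ltW // (lt_le_trans ak) // ge_min lexx.
  have b1 : b k <= 1 by rewrite ltW // (lt_le_trans bk) // ge_min lexx.
  have [d' dE] : exists d', d = d'.+1 by exists d.-1; rewrite prednK.
  have [e' eE] : exists e', e = e'.+1 by exists e.-1; rewrite prednK.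
  have est : eps * ((kg k)%:~R ^+ m.+1 * (kf k)%:~R ^+ n.+1) <= (C + C') * del.
    rewrite [leRHS]mulrDl /eps.
    have := @decay_estimate _ d' e' m n (s k) (t k) (kf k)%:~R (kg k)%:~R
      `|fR.[theta]| `|gR.[eta]| C C' sk tk kf1R kg1R.
    rewrite -dE -eE => /(_ md ne (normr_ge0 _) (normr_ge0 _) (ltW C0) (ltW C'0)).
    have e1 : e.-1 = e' by rewrite eE.
    have d1 : d.-1 = d' by rewrite dE.
    rewrite e1 in dF; rewrite d1 in dG.
    move=> /(_ dF dG); rewrite -/(a k) -/(b k) => /le_trans; apply.
    (* As [e - 1] and [d - 1] may vanish, [a^(e-1) b^d] is only bounded by [b], and [a^e b^(d-1)] by
       [a]. *)
    apply: lerD; apply: ler_wpM2l; rewrite ?(ltW C0) ?(ltW C'0) //.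
      apply: (@le_trans _ _ (b k)); last exact: ltW.
      rewrite dE exprS mulrCA; apply: ler_piMr => //.
      by apply: mulr_ile1; rewrite ?exprn_ge0 ?exprn_ile1.
    apply: (@le_trans _ _ (a k)); last exact: ltW.
    rewrite eE exprS -mulrA; apply: ler_piMr => //.
    by apply: mulr_ile1; rewrite ?exprn_ge0 ?exprn_ile1.
  apply: (le_lt_trans (ler_wpM2l K0 est)); rewrite mulrA.
  have : del <= c / (K * (C + C') + 1) by rewrite ge_min lexx orbT.
  rewrite ler_pdivlMr // => h; apply: lt_le_trans h.
  by rewrite [ltRHS]mulrDr mulr1 [ltLHS]mulrC ltrDl.
- have [kH hkH] := umk_surj (height (uresprod R F G)).
  have de0 : (0 < d * e)%N by rewrite muln_gt0 d0.
  (* Nonvanishing gives height at least 1, as [lt_growth] requires; it is read off the coefficient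
     whose index is the product of the degrees. *)
  have Hn0 : uresprod R F G != 0.
    apply/eqP => H0; have /umkP : umk (fun k =>
        (resprod R (pcomp F k) (pcomp G k))`_(m.+1 * n.+1)%N) = 0 :> ustar U int.
      by rewrite -rH.2 H0 coef0.
    move=> h; apply: (@usets0 U); apply: usetsS (usetsI h (usetsI szF szG)).
    move=> k /= [h0 [sf sg]].
    have f0 : pcomp F k != 0 by rewrite -size_poly_gt0 sf mE.
    have g0 : pcomp G k != 0 by rewrite -size_poly_gt0 sg nE.
    have sH := size_resprod R _ _ f0 g0; rewrite sf sg mE nE /= in sH.
    have : lead_coef (resprod R (pcomp F k) (pcomp G k)) = 0 by rewrite /lead_coef sH.
    by move=> /eqP; rewrite lead_coef_eq0 -size_poly_eq0 sH.
  have kH1 : U [set n | 1 <= kH n].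
    by apply: usetsS (height_pcomp _ _ _ Hn0 hkH) => k /= [].
  have st0 : U [set n | 0 <= s n * t n].
    by apply: usetsS (usetsI s0 t0) => k /= [sk tk]; rewrite mulr_ge0.
  apply/(lt_growth _ _ _ _ _ _ de0 hkH kH1 st0) => c c0.
  have [i hi] := height_attained _ (uresprod R F G).
  have kHi : U [set k | kH k = `|(resprod R (pcomp F k) (pcomp G k))`_i|].
    by apply/umkP; rewrite -hkH hi rH.2 umk_norm.
  pose K : R := (m.+1 + n.+1)`!%:R.
  have K0 : 0 < K by rewrite ltr0n fact_gt0.
  pose del := Num.min 1 (c / K).
  have del0 : 0 < del by rewrite lt_min ltr01 divr_gt0.
  apply: usetsS (usetsI (usetsI (grF _ del0) (grG _ del0)) (usetsI kHi
    (usetsI (usetsI hF hG) (usetsI (usetsI s0 t0) (usetsI szF szG))))) => k /=.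
  move=> [[]]; rewrite -/(a k) -/(b k) => ak bk.
  move=> [-> [[[f1 bf] [g1 bg]] [[sk tk] [sf sg]]]].
  have f0 : pcomp F k != 0 by rewrite -size_poly_gt0 sf mE.
  have g0 : pcomp G k != 0 by rewrite -size_poly_gt0 sg nE.
  have kf1R : 1 <= (kf k)%:~R :> R by rewrite ler1z.
  have kg1R : 1 <= (kg k)%:~R :> R by rewrite ler1z.
  have a0 : 0 <= a k by rewrite mulr_ge0 ?exprn_ge0 // (le_trans _ kf1R).
  have b0 : 0 <= b k by rewrite mulr_ge0 ?exprn_ge0 // (le_trans _ kg1R).
  have a1 : a k <= 1 by rewrite ltW // (lt_le_trans ak) // ge_min lexx.
  have b1 : b k <= 1 by rewrite ltW // (lt_le_trans bk) // ge_min lexx.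
  rewrite resprodE // sf sg mE nE /=.
  have : (`|(resdet m.+1 n.+1 (pcomp F k) (pcomp G k))`_i|%:~R : R) <=
      K * ((kg k)%:~R ^+ m.+1 * (kf k)%:~R ^+ n.+1).
    have := coef_resdet_le m.+1 n.+1 _ _ _ _ i bf bg.
    by rewrite -(ler_int R) !rmorphM !rmorphXn /= -pmulrn rmorph_nat.
  move=> hle.
  have stX : 0 <= (s k * t k) ^+ (d * e) by rewrite exprn_ge0 // mulr_ge0.
  apply: (le_lt_trans (ler_wpM2l stX hle)); rewrite mulrCA.
  (* Since [e > 0] and [a], [b] are at most 1, the product [a^e b^d] is at most [a]. *)
  apply: (@le_lt_trans _ _ (K * (a k))).
    apply: ler_wpM2l; first exact: ltW.
    apply: (le_trans (growth_estimate d e m.+1 n.+1 _ _ _ _ sk tk kf1R kg1R md ne)).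
    rewrite -/(a k) -/(b k) -[in X in X * _](prednK e0) exprS -mulrA.
    by apply: ler_piMr => //; apply: mulr_ile1; rewrite ?exprn_ge0 ?exprn_ile1.
  have : del <= c / K by rewrite ge_min lexx orbT.
  by move=> /(lt_le_trans ak); rewrite ltr_pdivlMr // mulrC.
Qed.

End Main.

Theorem theorem6p5 (R : realType) (U : npultra) (theta eta : R) (d e : nat)
    (mu nu : PR U R) (d_gt0 : (0 < d)%N) (e_gt0 : (0 < e)%N)
    (mu_eps : PReps mu) (nu_eps : PReps nu) :
  [/\ (forall f g : {poly int}, (1 < size f)%N -> (1 < size g)%N ->
         polyZC R (resprod R f g) = resprodC (polyZC R f) (polyZC R g)),
      (forall (F G : {poly ustar U int}) (f g : nat -> {poly int}),
         (1 < size F)%N -> (1 < size G)%N ->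
         represents f F -> represents g G ->
         represents (fun n => resprod R (f n) (g n)) (uresprod R F G)),
      (forall F G : {poly ustar U int}, (1 < size F)%N -> (1 < size G)%N ->
         Zmunu mu (prmul (prexp mu e.-1) (prexp nu e)) theta d F ->
         Zmunu nu (prmul (prexp mu d) (prexp nu d.-1)) eta e G ->
         Zmu (prmul mu nu) (theta * eta) (d * e) (uresprod R F G)),
      (forall F F' G : {poly ustar U int},
         (1 < size F)%N -> (1 < size F')%N -> (1 < size G)%N ->
         uresprod R (F * F') G = uresprod R F G * uresprod R F' G
         /\ uresprod R G (F * F') = uresprod R G F * uresprod R G F')
    & (forall m m' n n' : ustar U int, m != 0 -> n != 0 ->
         uresprod R (m *: 'X - m'%:P) (n *: 'X - n'%:P)
         = (m * n) *: 'X - (m' * n')%:P)].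
Proof.
have nz (A : nzRingType) (p : {poly A}) : (1 < size p)%N -> p != 0.
  by move=> sp; rewrite -size_poly_gt0 ltnW.
split.
- by move=> f g /nz f0 /nz g0; exact: polyZC_resprod.
- by move=> F G f g /nz F0 /nz G0; exact: represents_uresprod.
- by move=> F G sF sG; exact: uresprod_Zmu.
(* Commutativity reduces the second variable to the first. *)
- move=> F F' G /nz F0 /nz F'0 /nz G0; rewrite !(uresprodC _ _ G).
  by split; exact: uresprod_mull.
- exact: uresprod_linear.
Qed.
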